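(* Let $G$ be a six-dimensional non-nilpotent almost abelian Lie group. Then $G$ admits a left-invariant complex structure if and only if its Lie algebra $\mathfrak{g}$ is isomorphic to one of the following (all parameters are real): - $\mathfrak{k}_1^{p,r}=(f^{16},pf^{26},pf^{36},rf^{46},rf^{56},0)$, $1\geq|p|\geq|r|>0$; - $\mathfrak{k}_2^{q,r}=(f^{16},f^{26},qf^{36},rf^{46},rf^{56},0)$, $1>|q|\geq|r|>0$; - $\mathfrak{k}_3^{q,s}=(f^{16},f^{26},qf^{36},qf^{46},sf^{56},0)$, $1\geq|q|>|s|>0$; - $\mathfrak{k}_4^{q}=(f^{16},f^{26}+f^{36},f^{36},qf^{46},qf^{56},0)$, $1\geq|q|>0$; - $\mathfrak{k}_5^{p}=(f^{16},pf^{26}+f^{36},pf^{36},f^{46},pf^{56},0)$, $1>|p|>0$; - $\mathfrak{k}_6^{p}=(f^{16},pf^{26}+f^{36},pf^{36},pf^{46}+f^{56},pf^{56},0)$; - $\mathfrak{k}_7^{p}=(pf^{16}+f^{26},pf^{26}+f^{36},pf^{36},pf^{46}+f^{56},pf^{56},0)$, $p\neq0$; - $\mathfrak{k}_8^{p,q,s}=(pf^{16},qf^{26},qf^{36},sf^{46}+f^{56},-f^{46}+sf^{56},0)$, $|p|\geq|q|>0$; - $\mathfrak{k}_9^{p,r,s}=(pf^{16},pf^{26},rf^{36},sf^{46}+f^{56},-f^{46}+sf^{56},0)$, $|p|>|r|>0$; - $\mathfrak{k}_{10}^{p,r}=(pf^{16},pf^{26}+f^{36},pf^{36},rf^{46}+f^{56},-f^{46}+rf^{56},0)$,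 $p\neq0$; - $\mathfrak{k}_{11}^{p,q,r,s}=(pf^{16},qf^{26}+f^{36},-f^{26}+qf^{36},rf^{46}+sf^{56},-sf^{46}+rf^{56},0)$, $ps\neq0$ and ($|q|>|r|$, or $|q|=|r|$ and $|s|\leq1$); - $\mathfrak{k}_{12}^{p,q}=(pf^{16},qf^{26}+f^{36}-f^{46},-f^{26}+qf^{36}-f^{56},qf^{46}+f^{56},-f^{46}+qf^{56},0)$, $p\neq0$; - $\mathfrak{k}_{13}=(f^{16},0,0,0,0,0)$; - $\mathfrak{k}_{14}=(f^{16},f^{26},0,0,0,0)$; - $\mathfrak{k}_{15}^p=(pf^{16}+f^{26},-f^{16}+pf^{26},0,0,0,0)$; - $\mathfrak{k}_{16}=(f^{16},f^{26}+f^{36},f^{36},0,0,0)$; - $\mathfrak{k}_{17}^p=(f^{16},pf^{26},pf^{36},0,0,0)$, $1\geq|p|>0$; - $\mathfrak{k}_{18}^q=(f^{16},f^{26},qf^{36},0,0,0)$, $1>|q|>0$; - $\mathfrak{k}_{19}^{p,q}=(pf^{16},qf^{26}+f^{36},-f^{26}+qf^{36},0,0,0)$, $p\neq0$; - $\mathfrak{k}_{20}^q=(f^{16},f^{26},qf^{36},qf^{46},0,0)$, $1\geq|q|>0$; - $\mathfrak{k}_{21}=(f^{16},f^{26},f^{46},0,0,0)$; - $\mathfrak{k}_{22}^{q,r}=(f^{16},f^{26},qf^{36}+rf^{46},-rf^{36}+qf^{46},0,0)$, $r\neq0$; - $\mathfrak{k}_{23}^p=(pf^{16}+f^{26},-f^{16}+pf^{26},f^{46},0,0,0)$;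 - $\mathfrak{k}_{24}=(f^{16}+f^{26},f^{26},f^{36}+f^{46},f^{46},0,0)$; - $\mathfrak{k}_{25}^{p,q,r}=(pf^{16}+f^{26},-f^{16}+pf^{26},qf^{36}+rf^{46},-rf^{36}+qf^{46},0,0)$, $r\neq0$ and ($|p|>|q|$, or $|p|=|q|$ and $|r|\leq1$); - $\mathfrak{k}_{26}^p=(pf^{16}+f^{26}-f^{36},-f^{16}+pf^{26}-f^{46},pf^{36}+f^{46},-f^{36}+pf^{46},0,0)$. Moreover, an explicit complex structure $J$ on each of these Lie algebras is given, in terms of the dual basis $\{f_1,\ldots,f_6\}$, by: - $Jf_1=f_6,\ Jf_2=f_3,\ Jf_4=f_5$ on $\mathfrak{k}_1^{p,r}$, $\mathfrak{k}_8^{p,q,s}$, $\mathfrak{k}_{11}^{p,q,r,s}$, $\mathfrak{k}_{12}^{p,q}$, $\mathfrak{k}_{13}$, $\mathfrak{k}_{17}^p$, $\mathfrak{k}_{19}^{p,q}$; - $Jf_1=f_2,\ Jf_3=f_6,\ Jf_4=f_5$ on $\mathfrak{k}_2^{q,r}$, $\mathfrak{k}_9^{p,r,s}$, $\mathfrak{k}_{18}^q$; - $Jf_1=f_2,\ Jf_3=f_4,\ Jf_5=f_6$ on $\mathfrak{k}_3^{q,s}$, $\mathfrak{k}_{14}$, $\mathfrak{k}_{15}^p$, $\mathfrak{k}_{20}^q$, $\mathfrak{k}_{22}^{q,r}$, $\mathfrak{k}_{25}^{p,q,r}$, $\mathfrak{k}_{26}^p$; - $Jf_2=f_1,\ Jf_3=f_6,\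 Jf_4=f_5$ on $\mathfrak{k}_4^q$, $\mathfrak{k}_{10}^{p,r}$, $\mathfrak{k}_{16}$; - $Jf_1=f_4,\ Jf_2=f_5,\ Jf_3=f_6$ on $\mathfrak{k}_5^p$, $\mathfrak{k}_7^p$; - $Jf_1=f_6,\ Jf_2=f_4,\ Jf_3=f_5$ on $\mathfrak{k}_6^p$; - $Jf_1=f_2,\ Jf_3=f_5,\ Jf_4=f_6$ on $\mathfrak{k}_{21}$, $\mathfrak{k}_{23}^p$; - $Jf_1=f_3,\ Jf_2=f_4,\ Jf_5=f_6$ on $\mathfrak{k}_{24}$.
   Context: An almost abelian Lie group is a (real) connected Lie group whose Lie algebra has a codimension-one abelian ideal; throughout, such groups are assumed connected and simply connected. Notation for Lie algebras: $(\alpha_1,\ldots,\alpha_6)$ denotes the real six-dimensional Lie algebra with a basis of 1-forms $\{f^1,\ldots,f^6\}$ satisfying $df^i=\alpha_i$, where $d$ is the Chevalley–Eilenberg differential ($d\alpha(X,Y)=-\alpha([X,Y])$ for a 1-form $\alpha$) and $f^{ij}=f^i\wedge f^j$; $\{f_1,\ldots,f_6\}$ denotes the dual basis of the Lie algebra. For instance $(f^{16},0,0,0,0,0)$ means $df^1=f^1\wedge f^6$, $df^j=0$ for $j=2,\ldots,6$. A left-invariant complex structure on $G$ is identified with an integrable almost complex structure $J$ on $\mathfrak{g}$, i.e. $J\in\mathrm{End}(\mathfrak{g})$ with $J^2=-\mathrm{Id}$ and vanishing Nijenhuis tensor. When $J$ is specified by three equations $Jf_i=f_j$, it is understood that $Jf_j=-f_i$.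 *)

(* Defs.v *)
From mathcomp Require Import all_boot all_order all_algebra.
From mathcomp Require Import reals.

Set Implicit Arguments.
Unset Strict Implicit.
Unset Printing Implicit Defensive.

Import Order.TTheory GRing.Theory Num.Theory.
Local Open Scope ring_scope.

Section LieAlgebra.
Variables (R : fieldType) (V : vectType R).
Implicit Types (br : V -> V -> V) (U W : {vspace V}) (J : 'End(V)).

Record is_lie_bracket br : Prop := IsLieBracket {
  lie_linearl : forall y, linear (br ^~ y);
  lie_linearr : forall x, linear (br x);
  lie_alternating : forall x, br x x = 0;
  lie_jacobi : forall x y z,
    br x (br y z) + br y (br z x) + br z (br x y) = 0
}.

(* The span of all br u w with u in U and w in W; by bilinearity it is enough
   to take u and w in bases (same encoding as prodv in falgebra). *)
Definition lie_prodv br U W : {vspace V} :=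
  <<allpairs br (vbasis U) (vbasis W)>>%VS.

Fixpoint lower_central br (n : nat) : {vspace V} :=
  if n is m.+1 then lie_prodv br fullv (lower_central br m) else fullv.

Definition nilpotent_lie br : Prop := exists n, lower_central br n = 0%VS.

Definition lie_ideal br U : Prop := forall x u, u \in U -> br x u \in U.

Definition lie_abelian br U : Prop :=
  forall u w, u \in U -> w \in U -> br u w = 0.

Definition almost_abelian br : Prop :=
  exists U, [/\ (\dim U).+1 = \dim {:V}, lie_ideal br U & lie_abelian br U].

Definition nijenhuis br J (x y : V) : V :=
  br x y + J (br (J x) y + br x (J y)) - br (J x) (J y).

Definition complex_structure br J : Prop :=
  (forall x, J (J x) = - x) /\ (forall x y, nijenhuis br J x y = 0).

End LieAlgebra.

Definition lie_isomorphic (R : fieldType) (V W : vectType R)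
    (brV : V -> V -> V) (brW : W -> W -> W) : Prop :=
  exists phi : 'Hom(V, W),
    bijective phi /\ forall x y, phi (brV x y) = brW (phi x) (phi y).

(* Indices are 1-based, as in f_1, ..., f_6. *)
Definition ix (k : nat) : 'I_6 := inord k.-1.

Section StructureEquations.
Variable R : fieldType.

Definition basis6 (k : nat) : 'rV[R]_6 := delta_mx 0 (ix k).

(* A 2-form alpha on R^6 is encoded by its antisymmetric Gram matrix, so that
   alpha(x, y) = x *m alpha *m y^T; [form2 i j] is f^i /\ f^j, that is
   (x, y) |-> x_i y_j - x_j y_i. *)
Definition form2 (i j : nat) : 'M[R]_6 :=
  delta_mx (ix i) (ix j) - delta_mx (ix j) (ix i).

Definition form2_eval (alpha : 'M[R]_6) (x y : 'rV[R]_6) : R :=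
  (x *m alpha *m y^T) 0 0.

(* The bracket with structure equations df^i = alpha_i. Since
   df^i(x, y) = - f^i([x, y]), the i-th coordinate of [x, y] is
   - alpha_i(x, y). *)
Definition bracket_of (alpha : 6.-tuple 'M[R]_6) (x y : 'rV[R]_6) : 'rV[R]_6 :=
  \row_(i < 6) - form2_eval (tnth alpha i) x y.

Definition specified_by (J : 'End('rV[R]_6)) (s : seq (nat * nat)) : Prop :=
  forall i j, (i, j) \in s ->
    J (basis6 i) = basis6 j /\ J (basis6 j) = - basis6 i.

End StructureEquations.

Section Classification.
Variable R : realFieldType.

Local Notation f16 := (@form2 R 1 6).
Local Notation f26 := (@form2 R 2 6).
Local Notation f36 := (@form2 R 3 6).
Local Notation f46 := (@form2 R 4 6).
Local Notation f56 := (@form2 R 5 6).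

(* [listed alpha s]: alpha is the tuple of structure equations of one of the
   Lie algebras of the list, and s the pairs (i, j) such that J f_i = f_j for
   the complex structure J given on it. *)
Inductive listed : 6.-tuple 'M[R]_6 -> seq (nat * nat) -> Prop :=
| k1 (p r : R) :
    [/\ 1 >= `|p|, `|p| >= `|r| & `|r| > 0] ->
    listed [tuple f16; p *: f26; p *: f36; r *: f46; r *: f56; 0]
           [:: (1, 6); (2, 3); (4, 5)]%N
| k2 (q r : R) :
    [/\ 1 > `|q|, `|q| >= `|r| & `|r| > 0] ->
    listed [tuple f16; f26; q *: f36; r *: f46; r *: f56; 0]
           [:: (1, 2); (3, 6); (4, 5)]%N
| k3 (q s : R) :
    [/\ 1 >= `|q|, `|q| > `|s| & `|s| > 0] ->
    listed [tuple f16; f26; q *: f36; q *: f46; s *: f56; 0]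
           [:: (1, 2); (3, 4); (5, 6)]%N
| k4 (q : R) :
    1 >= `|q| /\ `|q| > 0 ->
    listed [tuple f16; f26 + f36; f36; q *: f46; q *: f56; 0]
           [:: (2, 1); (3, 6); (4, 5)]%N
| k5 (p : R) :
    1 > `|p| /\ `|p| > 0 ->
    listed [tuple f16; p *: f26 + f36; p *: f36; f46; p *: f56; 0]
           [:: (1, 4); (2, 5); (3, 6)]%N
| k6 (p : R) :
    listed [tuple f16; p *: f26 + f36; p *: f36; p *: f46 + f56; p *: f56; 0]
           [:: (1, 6); (2, 4); (3, 5)]%N
| k7 (p : R) :
    p != 0 ->
    listed [tuple p *: f16 + f26; p *: f26 + f36; p *: f36;
                  p *: f46 + f56; p *: f56; 0]
           [:: (1, 4); (2, 5); (3, 6)]%N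
| k8 (p q s : R) :
    `|p| >= `|q| /\ `|q| > 0 ->
    listed [tuple p *: f16; q *: f26; q *: f36;
                  s *: f46 + f56; - f46 + s *: f56; 0]
           [:: (1, 6); (2, 3); (4, 5)]%N
| k9 (p r s : R) :
    `|p| > `|r| /\ `|r| > 0 ->
    listed [tuple p *: f16; p *: f26; r *: f36;
                  s *: f46 + f56; - f46 + s *: f56; 0]
           [:: (1, 2); (3, 6); (4, 5)]%N
| k10 (p r : R) :
    p != 0 ->
    listed [tuple p *: f16; p *: f26 + f36; p *: f36;
                  r *: f46 + f56; - f46 + r *: f56; 0]
           [:: (2, 1); (3, 6); (4, 5)]%N
| k11 (p q r s : R) :
    p * s != 0 /\ (`|q| > `|r| \/ (`|q| = `|r| /\ `|s| <= 1)) ->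
    listed [tuple p *: f16; q *: f26 + f36; - f26 + q *: f36;
                  r *: f46 + s *: f56; - (s *: f46) + r *: f56; 0]
           [:: (1, 6); (2, 3); (4, 5)]%N
| k12 (p q : R) :
    p != 0 ->
    listed [tuple p *: f16; q *: f26 + f36 - f46; - f26 + q *: f36 - f56;
                  q *: f46 + f56; - f46 + q *: f56; 0]
           [:: (1, 6); (2, 3); (4, 5)]%N
| k13 :
    listed [tuple f16; 0; 0; 0; 0; 0]
           [:: (1, 6); (2, 3); (4, 5)]%N
| k14 :
    listed [tuple f16; f26; 0; 0; 0; 0]
           [:: (1, 2); (3, 4); (5, 6)]%N
| k15 (p : R) :
    listed [tuple p *: f16 + f26; - f16 + p *: f26; 0; 0; 0; 0]
           [:: (1, 2); (3, 4); (5, 6)]%N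
| k16 :
    listed [tuple f16; f26 + f36; f36; 0; 0; 0]
           [:: (2, 1); (3, 6); (4, 5)]%N
| k17 (p : R) :
    1 >= `|p| /\ `|p| > 0 ->
    listed [tuple f16; p *: f26; p *: f36; 0; 0; 0]
           [:: (1, 6); (2, 3); (4, 5)]%N
| k18 (q : R) :
    1 > `|q| /\ `|q| > 0 ->
    listed [tuple f16; f26; q *: f36; 0; 0; 0]
           [:: (1, 2); (3, 6); (4, 5)]%N
| k19 (p q : R) :
    p != 0 ->
    listed [tuple p *: f16; q *: f26 + f36; - f26 + q *: f36; 0; 0; 0]
           [:: (1, 6); (2, 3); (4, 5)]%N
| k20 (q : R) :
    1 >= `|q| /\ `|q| > 0 ->
    listed [tuple f16; f26; q *: f36; q *: f46; 0; 0]
           [:: (1, 2); (3, 4); (5, 6)]%N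
| k21 :
    listed [tuple f16; f26; f46; 0; 0; 0]
           [:: (1, 2); (3, 5); (4, 6)]%N
| k22 (q r : R) :
    r != 0 ->
    listed [tuple f16; f26; q *: f36 + r *: f46; - (r *: f36) + q *: f46; 0; 0]
           [:: (1, 2); (3, 4); (5, 6)]%N
| k23 (p : R) :
    listed [tuple p *: f16 + f26; - f16 + p *: f26; f46; 0; 0; 0]
           [:: (1, 2); (3, 5); (4, 6)]%N
| k24 :
    listed [tuple f16 + f26; f26; f36 + f46; f46; 0; 0]
           [:: (1, 3); (2, 4); (5, 6)]%N
| k25 (p q r : R) :
    r != 0 /\ (`|p| > `|q| \/ (`|p| = `|q| /\ `|r| <= 1)) ->
    listed [tuple p *: f16 + f26; - f16 + p *: f26;
                  q *: f36 + r *: f46; - (r *: f36) + q *: f46; 0; 0]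
           [:: (1, 2); (3, 4); (5, 6)]%N
| k26 (p : R) :
    listed [tuple p *: f16 + f26 - f36; - f16 + p *: f26 - f46;
                  p *: f36 + f46; - f36 + p *: f46; 0; 0]
           [:: (1, 2); (3, 4); (5, 6)]%N.

End Classification.

(* Main.v *)
Require Import Defs.
From HB Require Import structures.
From mathcomp Require Import all_boot all_order all_algebra.
From mathcomp Require Import reals.
From mathcomp Require Import complex ring.

(** Structure equations df^i = theta_i /\ f^6, df^6 = 0 say that the bracket is
    [x, y] = x_6 D y - y_6 D x for the single operator D = ad f_6. For such a
    bracket the Nijenhuis tensor of J only involves the commutator of D with J,
    and it vanishes if and only if D commutes with J on the J-invariant part of
    the ideal ker f^6; on the plane spanned by f_6 and its partner there is no
    condition. Hence the given complex structures are checked by comparing a few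
    coefficients of each set of structure equations
    ([complex_structure_of_pairs], [listed_complex_structure]).

    Conversely, let U be an abelian ideal of dimension five of a Lie algebra with
    complex structure J. As J has no invariant subspace of odd dimension, U and
    J U meet in dimension four; choose e1 in U outside of J U and put
    e6 = J e1. Integrability says that A = ad e6 commutes with J on the complex
    plane U /\ J U, hence acts on it as a complex 2x2 matrix m, while
    A e1 = a e1 + v with a real and v in this plane ([exists_frame]). The choices
    left are a complex basis (w, w') of the plane and the translation of e1 by
    the plane: they conjugate m and change v modulo the image of m - a
    ([frame_change]). Since a complex 2x2 matrix has an eigenvector, this leads
    to four normal forms: m diagonal or a Jordan block, and v = 0 or, when a is an
    eigenvalue of m, v not in the image of m - a ([frame_normal]). If all the
    eigenvalues vanish then the Lie algebra is nilpotent ([frame_nilpotent]).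
    Otherwise e6 can be rescaled, and the list results from separating real from
    nonreal and zero from nonzero eigenvalues, and from comparing absolute values
    in order to choose which eigenvalue is normalized (the [classify] lemmas). *)

Set Implicit Arguments.
Unset Strict Implicit.
Unset Printing Implicit Defensive.

Import Order.TTheory GRing.Theory Num.Theory.
Local Open Scope ring_scope.

(** * Structure equations divisible by f^6 *)

Section SixTuples.
Variable R : fieldType.
Implicit Types (alpha : 6.-tuple 'M[R]_6) (x y : 'rV[R]_6).

Lemma val_ix k : (0 < k <= 6)%N -> ix k = k.-1 :> nat.
Proof. by case: k => // k /= lk6; rewrite /ix inordK. Qed.

Lemma eq_ix j k : (0 < j <= 6)%N -> (0 < k <= 6)%N -> (ix j == ix k) = (j == k).
Proof.
move=> hj hk; rewrite -val_eqE /= !val_ix //.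
by case: j hj => // j _; case: k hk.
Qed.

Lemma forall_ix (P : 'I_6 -> Prop) s :
  perm_eq s (iota 1 6) -> (forall k, k \in s -> P (ix k)) -> forall i, P i.
Proof.
move=> hs hP i; have -> : i = ix i.+1 by apply/val_inj; rewrite /= val_ix //= ltn_ord.
by apply: hP; rewrite (perm_mem hs) mem_iota /=; have := ltn_ord i.
Qed.

Lemma basis6_eq (m : nat) (A B : 'M[R]_(6, m)) s : perm_eq s (iota 1 6) ->
  (forall k, k \in s -> basis6 R k *m A = basis6 R k *m B) -> A = B.
Proof.
move=> hs hAB; apply/row_matrixP; apply: (forall_ix hs) => k /hAB.
by rewrite /basis6 -!rowE.
Qed.

Lemma mulmx_basis6 m (x : 'rV[R]_6) (A : 'M[R]_(6, m)) s : perm_eq s (iota 1 6) ->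
  x *m A = \sum_(k <- s) x 0 (ix k) *: (basis6 R k *m A).
Proof.
move=> hs; rewrite (perm_big _ hs) -[iota 1 6]/(map S (index_iota 0 6)) big_map.
rewrite big_mkord mulmx_sum_row; apply: eq_bigr => i _.
have -> : ix i.+1 = i by apply/val_inj; rewrite /= val_ix //= ltn_ord.
congr (_ *: _); rewrite /basis6 -rowE; congr row.
by apply/val_inj; rewrite /= val_ix //= ltn_ord.
Qed.

Lemma basis6_form2 i j k :
  (0 < i <= 6)%N -> (0 < j <= 6)%N -> (0 < k <= 6)%N ->
  basis6 R k *m form2 R i j = (k == i)%:R *: basis6 R j - (k == j)%:R *: basis6 R i.
Proof.
move=> hi hj hk; rewrite mulmxBr; congr (_ - _);
by rewrite mul_delta_mx_cond eq_ix // scaler_nat.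
Qed.

(** The matrix of ad f_6 acting on row vectors: the i-th coordinate of [f_6, f_j]
    is alpha_i(f_j, f_6). *)
Definition ad6 alpha : 'M[R]_6 := \matrix_(j, i) tnth alpha i j (ix 6).

Lemma ad6E alpha j i : (0 < i <= 6)%N ->
  ad6 alpha j (ix i) = nth 0 alpha i.-1 j (ix 6).
Proof. by move=> hi; rewrite mxE (tnth_nth 0) val_ix. Qed.

Lemma form2_6E k j : (0 < k < 6)%N -> (0 < j <= 6)%N ->
  form2 R k 6 (ix j) (ix 6) = (j == k)%:R.
Proof.
move=> /andP[k0 k6] hj; rewrite !mxE !eq_ix ?k0 ?(ltnW k6) // eqxx andbT.
by rewrite (gtn_eqF k6) andbF subr0.
Qed.

(** The 2-forms theta /\ f^6, where theta is read off the last column of the Gram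
    matrix. *)
Definition wedge6 (a : 'M[R]_6) : Prop := forall i j,
  a i j = a i (ix 6) * (j == ix 6)%:R - a j (ix 6) * (i == ix 6)%:R.

Lemma wedge6_0 : wedge6 0.
Proof. by move=> i j; rewrite !mxE !mul0r subr0. Qed.

Lemma wedge6D a b : wedge6 a -> wedge6 b -> wedge6 (a + b).
Proof. by move=> ha hb i j; rewrite !mxE ha hb; ring. Qed.

Lemma wedge6Z c a : wedge6 a -> wedge6 (c *: a).
Proof. by move=> ha i j; rewrite !mxE ha; ring. Qed.

Lemma wedge6_form2 k : (0 < k < 6)%N -> wedge6 (form2 R k 6).
Proof.
move=> /andP[k0 k6] i j; rewrite !mxE eqxx !eq_ix ?k0 ?(ltnW k6) //.
rewrite (gtn_eqF k6) !andbT !andbF !subr0 -!natrM !mulnb.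
by rewrite (andbC (j == _)).
Qed.

(** These are the structure equations for which ker f^6 is an abelian ideal. *)
Definition wedge6_eqs alpha : Prop :=
  (forall i, wedge6 (tnth alpha i)) /\ tnth alpha (ix 6) = 0.

Definition ad_bracket (D : 'M[R]_6) x y : 'rV[R]_6 :=
  x 0 (ix 6) *: (y *m D) - y 0 (ix 6) *: (x *m D).

Lemma form2_eval_wedge6 a x y : wedge6 a -> form2_eval a x y =
  y 0 (ix 6) * (x *m col (ix 6) a) 0 0 - x 0 (ix 6) * (y *m col (ix 6) a) 0 0.
Proof.
move=> ha; set c := col _ _; pose b := basis6 R 6.
have -> : a = c *m b - (c *m b)^T.
  apply/matrixP => i j; rewrite ha !mxE !big_ord1 !mxE eqxx.
  by ring.
have E (u v : 'rV_6) : (u *m (c *m b) *m v^T) 0 0 = v 0 (ix 6) * (u *m c) 0 0.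
  by rewrite !mulmxA -mulmxA mxE big_ord1 -rowE !mxE mulrC.
rewrite /form2_eval mulmxBr mulmxBl mxE [X in _ + X]mxE; congr (_ - _); first exact: E.
have -> : x *m (c *m b)^T *m y^T = (y *m (c *m b) *m x^T)^T.
  by rewrite !trmx_mul trmxK !mulmxA.
by rewrite mxE E.
Qed.

Lemma bracket_ofE alpha x y : wedge6_eqs alpha ->
  bracket_of alpha x y = ad_bracket (ad6 alpha) x y.
Proof.
move=> [hw _]; apply/rowP => i; rewrite !mxE form2_eval_wedge6 //.
have E z : (z *m col (ix 6) (tnth alpha i)) 0 0 = (z *m ad6 alpha) 0 i.
  by rewrite !mxE; apply: eq_bigr => j _; rewrite !mxE.
by rewrite !E !mxE; ring.
Qed.

Lemma ad6_last alpha x : wedge6_eqs alpha -> (x *m ad6 alpha) 0 (ix 6) = 0.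
Proof.
by move=> [_ h]; rewrite mxE big1 // => j _; rewrite !mxE h mxE mulr0.
Qed.

Lemma ad6_row6 alpha : wedge6_eqs alpha -> basis6 R 6 *m ad6 alpha = 0.
Proof.
move=> [h _]; rewrite /basis6 -rowE; apply/rowP => j.
by rewrite !mxE h eqxx mulr1 subrr.
Qed.

(** The derived algebra lies in ker f^6, so that in the Jacobi identity only the
    terms x_6 y_6 D (D z) remain, and they cancel in pairs. *)
Lemma is_lie_bracket_of alpha : wedge6_eqs alpha -> is_lie_bracket (bracket_of alpha).
Proof.
move=> h; have E := bracket_ofE _ _ h; split.
- move=> y c u v; rewrite !E /ad_bracket mulmxDl -scalemxAl.
  by apply/rowP => j; rewrite !mxE; ring.
- move=> x c u v; rewrite !E /ad_bracket mulmxDl -scalemxAl.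
  by apply/rowP => j; rewrite !mxE; ring.
- by move=> x; rewrite E /ad_bracket subrr.
move=> x y z; rewrite !E /ad_bracket.
have L (u v : 'rV[R]_6) :
    (u 0 (ix 6) *: (v *m ad6 alpha) - v 0 (ix 6) *: (u *m ad6 alpha)) 0 (ix 6) = 0.
  have D (a b : R) (p q : 'rV[R]_6) j : (a *: p - b *: q) 0 j = a * p 0 j - b * q 0 j.
    by rewrite !mxE.
  by rewrite D !ad6_last // !mulr0 subrr.
rewrite !L !scale0r !subr0 !mulmxBl -!scalemxAl.
move: (x *m _ *m _) (y *m _ *m _) (z *m _ *m _) => p q r.
by apply/rowP => j; rewrite !mxE; ring.
Qed.
End SixTuples.

(** * Integrability of a pairing of the basis *)

(** For a linear J with J^2 = -1, the commutator K = [D, J] of D = ad f_6 with J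
    anticommutes with J, and the Nijenhuis tensor only involves K. It vanishes as
    soon as K does on the vectors z such that z and J z lie in the ideal
    ker f^6. *)
Lemma nijenhuis_ad_bracket (R : fieldType) (J D : 'M[R]_6) (u x y : 'rV[R]_6) :
  J *m J = - 1%:M ->
  (forall z : 'rV[R]_6, z *m D *m J - z *m J *m D =
     (z *m J) 0 (ix 6) *: u - z 0 (ix 6) *: (u *m J)) ->
  nijenhuis (ad_bracket D) (linfun (mulmxr J)) x y = 0.
Proof.
move=> JJ zK; rewrite /nijenhuis !lfunE /= /ad_bracket mulmxDl !mulmxBl -!scalemxAl.
have vJJ (v : 'rV[R]_6) : v *m J *m J = - v by rewrite -mulmxA JJ mulmxN mulmx1.
have eKJ (z : 'rV[R]_6) : - (z *m D) - z *m J *m D *m J =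
   (z *m J) 0 (ix 6) *: (u *m J) + z 0 (ix 6) *: u.
  rewrite -[- (z *m D)]vJJ -mulmxBl zK mulmxBl -!scalemxAl vJJ.
  by rewrite scalerN opprK.
have hx := zK x; have hy := zK y; have hxJ := eKJ x; have hyJ := eKJ y.
move: hx hy hxJ hyJ.
move: (y *m J *m D *m J) (x *m J *m D *m J) => p q; move: (y *m J *m D) (x *m J *m D) => r s.
move: (y *m D *m J) (x *m D *m J) => t v; move: (y *m D) (x *m D) => w z.
move: ((x *m J) 0 _) ((y *m J) 0 _) (x 0 _) (y 0 _) (u *m J) => l m n o uJ hx hy hxJ hyJ.
have -> : v = l *: u - n *: uJ + s by rewrite -hx subrK.
have -> : t = m *: u - o *: uJ + r by rewrite -hy subrK.
have -> : p = - w - (m *: uJ + o *: u) by rewrite -hyJ opprB addrCA subrr addr0.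
have -> : q = - z - (l *: uJ + n *: u) by rewrite -hxJ opprB addrCA subrr addr0.
by apply/rowP => j; rewrite !mxE; ring.
Qed.

Section PairedComplexStructure.
Variable R : fieldType.
Variables (a b c d k : nat).
Hypothesis pairs : perm_eq [:: a; b; c; d; k; 6] (iota 1 6).
Local Notation e := (basis6 R).

(** J f_i = f_j and J f_j = - f_i for each pair (i, j): as an operator on row
    vectors, [form2 i j] is the rotation by a right angle in the plane of f_i and
    f_j. *)
Definition pairing_mx : 'M[R]_6 := form2 R a b + form2 R c d + form2 R k 6.
Local Notation J := pairing_mx.

Lemma basis6_pairing : [/\ e a *m J = e b, e b *m J = - e a, e c *m J = e d,
  e d *m J = - e c & e k *m J = e 6 /\ e 6 *m J = - e k].
Proof.
have hu : uniq [:: a; b; c; d; k; 6] by rewrite (perm_uniq pairs).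
have hr i : i \in [:: a; b; c; d; k; 6] -> (0 < i <= 6)%N.
  by rewrite (perm_mem pairs) mem_iota.
have [ha hb hc hd hk] : [/\ 0 < a <= 6, 0 < b <= 6, 0 < c <= 6, 0 < d <= 6 & 0 < k <= 6]%N.
  by split; apply: hr; rewrite !inE eqxx ?orbT.
move: hu; rewrite /= !inE !negb_or !andbT.
case/and5P => /and5P[ab ac ad ak a6] /and4P[bc bd bk b6] /and3P[cd ck c6] /andP[dk d6] k6.
have {}hr : (0 < 6 <= 6)%N by [].
have E m : e m *m J = e m *m form2 R a b + e m *m form2 R c d + e m *m form2 R k 6.
  by rewrite /J 2!mulmxDr.
rewrite !E !basis6_form2 // !eqxx.
by rewrite ![b == a]eq_sym ![c == a]eq_sym ![d == a]eq_sym ![k == a]eq_sym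
   ![c == b]eq_sym ![d == b]eq_sym ![k == b]eq_sym ![d == c]eq_sym ![k == c]eq_sym
   ![k == d]eq_sym ![6%N == _]eq_sym
   !(negPf ab, negPf ac, negPf ad, negPf ak, negPf a6, negPf bc, negPf bd, negPf bk,
     negPf b6, negPf cd, negPf ck, negPf c6, negPf dk, negPf d6, negPf k6)
   !(scale0r, scale1r, subr0, sub0r, add0r, addr0).
Qed.

Lemma pairing_mx_sqr : J *m J = - 1%:M.
Proof.
have [ha hb hc hd [hk h6]] := basis6_pairing.
apply: (basis6_eq pairs) => i; rewrite !inE mulmxA mulmxN mulmx1.
by do 5?[case/orP]; move=> /eqP->; rewrite !(ha, hb, hc, hd, hk, h6, mulNmx).
Qed.

(** Integrability only concerns the J-invariant part span(f_a, f_b, f_c, f_d) of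
    ker f^6, on which ad f_6 has to commute with J: on the plane of f_k and f_6
    the Nijenhuis tensor vanishes for any bracket. *)
Lemma nijenhuis_pairing (D : 'M[R]_6) x y :
  e b *m D = e a *m D *m J -> e d *m D = e c *m D *m J ->
  nijenhuis (ad_bracket D) (linfun (mulmxr J)) x y = 0.
Proof.
move=> hab hcd; have [ha hb hc hd [hk h6]] := basis6_pairing.
pose K := D *m J - J *m D.
have KJ : K *m J = - (J *m K).
  rewrite mulmxBl mulmxBr -!mulmxA pairing_mx_sqr !mulmxA pairing_mx_sqr.
  by rewrite mulmxN mulmx1 mulNmx mul1mx opprB.
have eK (z : 'rV[R]_6) : z *m K = z *m D *m J - z *m J *m D by rewrite mulmxBr !mulmxA.
have K0 : [/\ e a *m K = 0, e b *m K = 0, e c *m K = 0 & e d *m K = 0].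
  split; rewrite eK ?ha ?hb ?hc ?hd ?mulNmx ?hab ?hcd ?subrr //;
  by rewrite -[e _ *m D *m J *m J]mulmxA pairing_mx_sqr mulmxN mulmx1 subrr.
have K6 : e 6 *m K = - (e k *m K *m J).
  have -> : e k *m K *m J = - (e k *m J *m K).
    by rewrite -[LHS]mulmxA KJ mulmxN mulmxA.
  by rewrite opprK hk.
have zK z : z *m K = z 0 (ix k) *: (e k *m K) + z 0 (ix 6) *: (e 6 *m K).
  rewrite (mulmx_basis6 z K pairs) !big_cons big_nil.
  by case: K0 => -> -> -> ->; rewrite !scaler0 !add0r addr0.
have zJ (z : 'rV[R]_6) : (z *m J) 0 (ix 6) = z 0 (ix k).
  rewrite (mulmx_basis6 z J pairs) !big_cons big_nil ha hb hc hd hk h6.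
  have hu : uniq [:: a; b; c; d; k; 6] by rewrite (perm_uniq pairs).
  have hr i : i \in [:: a; b; c; d; k; 6] -> (0 < i <= 6)%N.
    by rewrite (perm_mem pairs) mem_iota.
  have e6 l : l \in [:: a; b; c; d; k] -> (e l) 0 (ix 6) = 0.
    move=> hl; have l6 : l != 6%N.
      apply: contraTneq hl => ->; move: hu.
      by rewrite -[_ :: _]/(rcons [:: a; b; c; d; k] 6) rcons_uniq => /andP[].
    rewrite mxE eqxx eq_ix // ?[6%N == _]eq_sym ?(negPf l6) // hr //.
    by rewrite -[_ :: _]/(rcons [:: a; b; c; d; k] 6) mem_rcons inE hl orbT.
  have e66 : (e 6) 0 (ix 6) = 1 by rewrite mxE !eqxx.
  have e6s : [/\ (e a) 0 (ix 6) = 0, (e b) 0 (ix 6) = 0, (e c) 0 (ix 6) = 0,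
    (e d) 0 (ix 6) = 0 & (e k) 0 (ix 6) = 0] by split; rewrite e6 // !inE eqxx ?orbT.
  move: (e a) (e b) (e c) (e d) (e k) (e 6) e66 e6s => va vb vc vd vk v6 e66 [ea eb ec ed ek].
  by rewrite !mxE ea eb ec ed ek e66; ring.
set u := e k *m K in K6 zK.
apply: (nijenhuis_ad_bracket (u := u)) (pairing_mx_sqr) _ => z.
by rewrite -eK zK zJ K6 scalerN.
Qed.

(** The coordinates of D f_q = J (D f_p) in the basis f_a, ..., f_6, where
    J f_p = f_q. *)
Lemma row_commute (D : 'M[R]_6) p q :
  (forall i j, (i, j) \in [:: (a, b); (c, d); (k, 6)] ->
    (D (ix q) (ix j) = D (ix p) (ix i)) * (D (ix q) (ix i) = - D (ix p) (ix j))) ->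
  e q *m D = e p *m D *m J.
Proof.
move=> h; have [ha hb hc hd [hk h6]] := basis6_pairing.
have E i j : (e i *m D) 0 j = D (ix i) j by rewrite -rowE mxE.
rewrite -[LHS]mulmx1 (mulmx_basis6 (e q *m D) 1%:M pairs) (mulmx_basis6 (e p *m D) J pairs).
rewrite !big_cons !big_nil ha hb hc hd hk h6 !mulmx1 !E.
rewrite !(h a b) ?(h c d) ?(h k 6) ?inE ?eqxx ?orbT //.
move: (e a) (e b) (e c) (e d) (e k) (e 6) => va vb vc vd vk v6.
by apply/rowP => j; rewrite !mxE; ring.
Qed.

End PairedComplexStructure.

(** * Coefficients of the structure equations *)

Section Rows.
Variable R : fieldType.
Implicit Types (A B : 'M[R]_6) (alpha : 6.-tuple 'M[R]_6) (M : nat -> nat -> R).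

Definition lin6 A (c : nat -> R) : Prop := A = \sum_(1 <= j < 6) c j *: form2 R j 6.

Lemma lin6_0 : lin6 0 (fun=> 0).
Proof. by rewrite /lin6 big1 // => j _; rewrite scale0r. Qed.

Lemma lin6_form2 k : (0 < k < 6)%N -> lin6 (form2 R k 6) (fun j => if j == k then 1 else 0).
Proof.
move=> hk; rewrite /lin6 (bigD1_seq k) ?mem_index_iota ?iota_uniq //= eqxx scale1r.
by rewrite big1 ?addr0 // => j /negPf->; rewrite scale0r.
Qed.

Lemma lin6D A B c c' : lin6 A c -> lin6 B c' -> lin6 (A + B) (fun j => c j + c' j).
Proof.
by move=> -> ->; rewrite /lin6 -big_split; apply: eq_bigr => j _; rewrite scalerDl.
Qed.

Lemma lin6N A c : lin6 A c -> lin6 (- A) (fun j => - c j).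
Proof. by move=> ->; rewrite /lin6 -sumrN; apply: eq_bigr => j _; rewrite scaleNr. Qed.

Lemma lin6Z a A c : lin6 A c -> lin6 (a *: A) (fun j => a * c j).
Proof. by move=> ->; rewrite /lin6 scaler_sumr; apply: eq_bigr => j _; rewrite scalerA. Qed.

Lemma lin6_wedge6 A c : lin6 A c -> wedge6 A.
Proof.
move=> ->; rewrite big_nat; apply: big_ind; first exact: wedge6_0.
  exact: wedge6D.
by move=> j hj; apply: wedge6Z; exact: wedge6_form2.
Qed.

Lemma lin6E A c j : lin6 A c -> (0 < j < 6)%N -> A (ix j) (ix 6) = c j.
Proof.
move=> -> hj; rewrite summxE (bigD1_seq j) ?mem_index_iota ?iota_uniq //=.
have h6 i : (0 < i < 6)%N -> (0 < i <= 6)%N by case/andP=> -> /ltnW.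
rewrite mxE form2_6E ?h6 // eqxx mulr1 big1_seq ?addr0 // => i /andP[ij].
rewrite mem_index_iota => hi; rewrite mxE form2_6E ?h6 // eq_sym.
by rewrite (negPf ij) mulr0.
Qed.

(** Rows and columns of M are numbered from 1, as the f^i are, and df^6 = 0. *)
Definition has_rows alpha M : Prop :=
  nth 0 alpha 5 = 0 /\ forall i, (0 < i < 6)%N -> lin6 (nth 0 alpha i.-1) (M i).

Lemma has_rows_tuple a1 a2 a3 a4 a5 c1 c2 c3 c4 c5 :
  lin6 a1 c1 -> lin6 a2 c2 -> lin6 a3 c3 -> lin6 a4 c4 -> lin6 a5 c5 ->
  has_rows [tuple a1; a2; a3; a4; a5; 0]
    (fun i => nth (fun=> 0) [:: c1; c2; c3; c4; c5] i.-1).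
Proof. by move=> *; split=> // -[|[|[|[|[|[|]]]]]]. Qed.

Lemma has_rows_wedge6 alpha M : has_rows alpha M -> wedge6_eqs alpha.
Proof.
case=> h6 h; split; last by rewrite (tnth_nth 0) val_ix.
apply: (forall_ix (perm_refl _)) => i; rewrite mem_iota (tnth_nth 0) => hi.
rewrite val_ix //; case: (ltnP i 6) => i6.
  by apply: (@lin6_wedge6 _ (M i)); apply: h; case/andP: hi => ->.
have -> : i = 6%N by apply/eqP; rewrite eqn_leq i6 andbT; case/andP: hi.
by rewrite h6; exact: wedge6_0.
Qed.

Lemma ad6_rows alpha M i j : has_rows alpha M -> (forall l, M 6 l = 0) ->
  (0 < j < 6)%N -> (0 < i <= 6)%N -> ad6 alpha (ix j) (ix i) = M i j.
Proof.
case=> h6 h M6 hj hi; rewrite ad6E //; case: (ltnP i 6) => i6.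
  by apply: lin6E => //; apply: h; case/andP: hi => ->.
have -> : i = 6%N by apply/eqP; rewrite eqn_leq i6 andbT; case/andP: hi.
by rewrite h6 mxE M6.
Qed.

(** D f_b = J D f_a implies J D f_b = - D f_a, so that for each pair inside ker f^6
    the commutation with J is tested on one of its members. *)
Lemma complex_structure_of_pairs alpha M s a b c d k :
  perm_eq [:: a; b; c; d; k; 6] (iota 1 6) ->
  perm_eq s [:: (a, b); (c, d); (k, 6)] ->
  has_rows alpha M -> (forall l, M 6 l = 0) ->
  (forall p q, (p, q) \in [:: (a, b); (c, d)] ->
     forall i j, (i, j) \in [:: (a, b); (c, d); (k, 6)] ->
     (M j q = M i p) * (M i q = - M j p)) ->
  is_lie_bracket (bracket_of alpha) /\
  exists J : 'End('rV[R]_6),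
    complex_structure (bracket_of alpha) J /\ specified_by J s.
Proof.
move=> hp hs hM M6 h; have hw := has_rows_wedge6 hM; split; first exact: is_lie_bracket_of.
have [ha hb hc hd [hk h6]] := basis6_pairing R hp.
exists (linfun (mulmxr (pairing_mx R a b c d k))); split; last first.
  move=> i j; rewrite (perm_mem hs) !inE !lfunE /=.
  by case/or3P => /eqP[-> ->]; rewrite ?ha ?hb ?hc ?hd ?hk ?h6.
split=> [x|x y]; first by rewrite !lfunE /= -mulmxA pairing_mx_sqr // mulmxN mulmx1.
have hr i : i \in [:: a; b; c; d; k; 6] -> (0 < i <= 6)%N.
  by rewrite (perm_mem hp) mem_iota.
have hu : uniq [:: a; b; c; d; k; 6] by rewrite (perm_uniq hp).
have h5 i : i \in [:: a; b; c; d] -> (0 < i < 6)%N.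
  move=> hi; have /andP[i0] : (0 < i <= 6)%N.
    by apply: hr; rewrite -[_ :: _]/([:: a; b; c; d] ++ [:: k; 6]) mem_cat hi.
  rewrite leq_eqVlt i0 => /orP[/eqP i6|//]; move: hu.
  rewrite -[_ :: _]/([:: a; b; c; d] ++ [:: k; 6]) cat_uniq => /and3P[_ /hasPn h6' _].
  have: (6 \in [:: k; 6])%N by rewrite !inE eqxx orbT.
  by move/h6'; rewrite -i6 /= hi.
have hrow p q : (p, q) \in [:: (a, b); (c, d)] ->
    basis6 R q *m ad6 alpha = basis6 R p *m ad6 alpha *m pairing_mx R a b c d k.
  move=> hpq; apply: (row_commute hp) => i j hij.
  have [hi hj] : i \in [:: a; b; c; d; k; 6] /\ j \in [:: a; b; c; d; k; 6].
    by move: hij; rewrite !inE => /or3P[] /eqP[-> ->]; rewrite !eqxx ?orbT.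
  have [hp' hq] : p \in [:: a; b; c; d] /\ q \in [:: a; b; c; d].
    by move: hpq; rewrite !inE => /orP[] /eqP[-> ->]; rewrite !eqxx ?orbT.
  by rewrite !(ad6_rows hM M6) ?h5 ?hr //; exact: h.
have hab : (a, b) \in [:: (a, b); (c, d)] by rewrite inE eqxx.
have hcd : (c, d) \in [:: (a, b); (c, d)] by rewrite !inE eqxx orbT.
rewrite -(nijenhuis_pairing hp x y (hrow _ _ hab) (hrow _ _ hcd)).
by rewrite /nijenhuis !(bracket_ofE _ _ hw).
Qed.
End Rows.

(* [lin6_form2] is tried first, because [form2] unfolds to a difference. *)
Ltac lin6_tac :=
  repeat (apply: lin6_form2 => // || apply: lin6_0 || apply: lin6D || apply: lin6N || apply: lin6Z).
Ltac rows_tac := apply: has_rows_tuple; lin6_tac.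

Ltac pairs_tac a b c d k :=
  apply: (@complex_structure_of_pairs _ _ _ _ a b c d k);
  [by [] | by [] | rows_tac | by [] | ];
  let p := fresh in let q := fresh in let i := fresh in let j := fresh in
  let h := fresh in
  move=> p q; rewrite !inE => /orP[] /eqP[-> ->] i j;
  rewrite !inE => /or3P[] /eqP[-> ->]; split=> /=;
  rewrite ?(mulr0, mulr1, addr0, add0r, subr0, sub0r, oppr0, opprK) //.

Lemma listed_complex_structure (R : realFieldType) (alpha : 6.-tuple 'M[R]_6) s :
  listed alpha s ->
  is_lie_bracket (bracket_of alpha) /\
  exists J : 'End('rV[R]_6),
    complex_structure (bracket_of alpha) J /\ specified_by J s.
Proof.
case=> *.
- pairs_tac 2%N 3%N 4%N 5%N 1%N.
- pairs_tac 1%N 2%N 4%N 5%N 3%N.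
- pairs_tac 1%N 2%N 3%N 4%N 5%N.
- pairs_tac 2%N 1%N 4%N 5%N 3%N.
- pairs_tac 1%N 4%N 2%N 5%N 3%N.
- pairs_tac 2%N 4%N 3%N 5%N 1%N.
- pairs_tac 1%N 4%N 2%N 5%N 3%N.
- pairs_tac 2%N 3%N 4%N 5%N 1%N.
- pairs_tac 1%N 2%N 4%N 5%N 3%N.
- pairs_tac 2%N 1%N 4%N 5%N 3%N.
- pairs_tac 2%N 3%N 4%N 5%N 1%N.
- pairs_tac 2%N 3%N 4%N 5%N 1%N.
- pairs_tac 2%N 3%N 4%N 5%N 1%N.
- pairs_tac 1%N 2%N 3%N 4%N 5%N.
- pairs_tac 1%N 2%N 3%N 4%N 5%N.
- pairs_tac 2%N 1%N 4%N 5%N 3%N.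
- pairs_tac 2%N 3%N 4%N 5%N 1%N.
- pairs_tac 1%N 2%N 4%N 5%N 3%N.
- pairs_tac 2%N 3%N 4%N 5%N 1%N.
- pairs_tac 1%N 2%N 3%N 4%N 5%N.
- pairs_tac 1%N 2%N 3%N 5%N 4%N.
- pairs_tac 1%N 2%N 3%N 4%N 5%N.
- pairs_tac 1%N 2%N 3%N 5%N 4%N.
- pairs_tac 1%N 3%N 2%N 4%N 5%N.
- pairs_tac 1%N 2%N 3%N 4%N 5%N.
- pairs_tac 1%N 2%N 3%N 4%N 5%N.
Qed.

(** * Lie brackets with an abelian ideal of codimension one *)

Section BracketTheory.
Variables (R : fieldType) (g : vectType R) (br : g -> g -> g).
Hypothesis hbr : is_lie_bracket br.

Lemma brDr x y z : br x (y + z) = br x y + br x z.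
Proof. by have := lie_linearr hbr x 1 y z; rewrite !scale1r. Qed.
Lemma br0r x : br x 0 = 0.
Proof. by apply: (addrI (br x 0)); rewrite -brDr !addr0. Qed.
Lemma brZr x a y : br x (a *: y) = a *: br x y.
Proof. by have := lie_linearr hbr x a y 0; rewrite br0r !addr0. Qed.
Lemma brDl x y z : br (x + y) z = br x z + br y z.
Proof. by have := lie_linearl hbr z 1 x y; rewrite /= !scale1r. Qed.
Lemma br0l x : br 0 x = 0.
Proof. by apply: (addrI (br 0 x)); rewrite -brDl !addr0. Qed.
Lemma brZl a x y : br (a *: x) y = a *: br x y.
Proof. by have := lie_linearl hbr y a x 0; rewrite /= br0l !addr0. Qed.
Lemma brC x y : br x y = - br y x.
Proof.
apply/eqP; rewrite -addr_eq0; have := lie_alternating hbr (x + y).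
by rewrite brDl !brDr !(lie_alternating hbr) add0r addr0 => ->.
Qed.
Lemma br_sumr x I (r : seq I) (F : I -> g) :
  br x (\sum_(i <- r) F i) = \sum_(i <- r) br x (F i).
Proof. exact: (big_morph (br x) (brDr x) (br0r x)). Qed.

Definition coords (f : 6.-tuple g) (x : g) : 'rV[R]_6 := \row_i coord f i x.

Fact coords_linear f : linear (coords f).
Proof. by move=> a x y; apply/rowP => i; rewrite !mxE linearP. Qed.
HB.instance Definition _ f := GRing.isLinear.Build R g 'rV[R]_6 _ (coords f) (coords_linear f).

(** If the first five vectors of a basis span an abelian ideal, then the bracket
    is determined by the adjoint action of the sixth. *)
Lemma lie_isomorphic_basis (U : {vspace g}) (f : 6.-tuple g) (alpha : 6.-tuple 'M[R]_6) :
  wedge6_eqs alpha -> lie_abelian br U -> basis_of fullv f ->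
  (forall i : 'I_6, (i < 5)%N -> f`_i \in U) ->
  (forall i : 'I_6, br f`_5 f`_i = \sum_k ad6 alpha i k *: f`_k) ->
  lie_isomorphic br (bracket_of alpha).
Proof.
move=> hw hab hf hU hA; have [hspan hfree] := (span_basis hf, basis_free hf).
pose psi (u : 'rV[R]_6) := \sum_i u 0 i *: f`_i.
have phiK x : psi (coords f x) = x.
  rewrite [RHS](@coord_span _ _ _ f) ?hspan ?memvf //.
  by apply: eq_bigr => i _; rewrite mxE.
have psiK u : coords f (psi u) = u.
  by apply/rowP => i; rewrite mxE coord_sum_free.
exists (linfun (coords f)); split.
  by exists psi => x; rewrite lfunE /=; [exact: phiK | exact: psiK].
move=> x y; rewrite !lfunE /= -{1}[x]phiK -{1}[y]phiK.
move: (coords f x) (coords f y) => u v; rewrite -[RHS]psiK; congr coords.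
have last5 : ix 6 = ord_max by apply/val_inj; rewrite /= val_ix.
have split6 z : exists2 z', z' \in U & psi z = z' + z 0 (ix 6) *: f`_5.
  exists (\sum_(i < 5) z 0 (widen_ord (leqnSn 5) i) *: f`_i).
    apply: memv_suml => i _; apply: memvZ.
    by apply: (hU (widen_ord (leqnSn 5) i)); rewrite /= ltn_ord.
  by rewrite /psi big_ord_recr last5.
have Apsi z : br f`_5 (psi z) = psi (z *m ad6 alpha).
  rewrite br_sumr /psi.
  under eq_bigr => i _ do rewrite brZr hA scaler_sumr.
  rewrite exchange_big; apply: eq_bigr => k _; rewrite mxE scaler_suml.
  by apply: eq_bigr => i _; rewrite scalerA.
have psiB a b z z' : psi (a *: z - b *: z') = a *: psi z - b *: psi z'.
  rewrite /psi !scaler_sumr -sumrB; apply: eq_bigr => i _.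
  by rewrite !mxE scalerBl !scalerA.
rewrite bracket_ofE // /ad_bracket psiB -!Apsi.
have [u' hu ->] := split6 u; have [v' hv ->] := split6 v.
rewrite !brDl !brDr !brZl !brZr (lie_alternating hbr) !scaler0 !addr0.
by rewrite (hab u' v') // add0r (brC u') scalerN addrC.
Qed.

End BracketTheory.

(** * The complex vector space defined by J *)

Section ComplexAction.
Variables (R : rcfType) (g : vectType R) (J : 'End(g)).
Hypothesis JJ : forall x, J (J x) = - x.

(** The structure of vector space over R[i] given by J. *)
Definition cact (z : R[i]) (x : g) : g := complex.Re z *: x + complex.Im z *: J x.
Local Notation "z • x" := (cact z x) (at level 40).

Lemma cactDl z z' x : (z + z') • x = z • x + z' • x.
Proof. by case: z z' => [a b] [c d]; rewrite /cact /= !scalerDl addrACA. Qed.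
Lemma cactDr z x y : z • (x + y) = z • x + z • y.
Proof. by rewrite /cact (linearD J) !scalerDr addrACA. Qed.
Lemma cactA z z' x : z • (z' • x) = (z * z') • x.
Proof.
case: z z' => [a b] [c d]; rewrite /cact /= (linearD J) !(linearZZ J) /= JJ.
rewrite !scalerDr !scalerA !scalerDl !scalerN !scaleNr -!addrA; congr (_ + _).
by rewrite [RHS]addrC -!addrA addrCA; congr (_ + _); rewrite addrC.
Qed.
Lemma cact0 x : 0 • x = 0.
Proof. by rewrite /cact /= !scale0r addr0. Qed.
Lemma cact_real a x : (a%:C)%C • x = a *: x.
Proof. by rewrite /cact /= scale0r addr0. Qed.
Lemma J_cact z x : J (z • x) = z • J x.
Proof. by rewrite /cact (linearD J) !(linearZZ J). Qed.
End ComplexAction.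

(** * Frames adapted to a complex structure *)

Section Frames.
Variables (R : rcfType) (g : vectType R) (br : g -> g -> g) (U : {vspace g}).
Variables (J : 'End(g)) (e6 : g).
Hypothesis hbr : is_lie_bracket br.
Hypothesis hU : lie_abelian br U.
Hypothesis JJ : forall x, J (J x) = - x.
Hypothesis brJ : forall x, x \in U -> J x \in U -> br e6 (J x) = J (br e6 x).
Local Notation "z • x" := (cact J z x) (at level 40).

(** The vectors w, w' generate over R[i] the J-invariant part of U, e1 completes it
    to U and e6 is the vector fixed throughout. The matrix (m11, m12; m21, m22)
    acts on the pair (w, w') from the left, as the rows are the images of w, w'. *)
Definition frame (a : R) (v1 v2 m11 m12 m21 m22 : R[i]) : Prop :=
  exists e1 w w',
  [/\ [/\ e1 \in U, w \in U, J w \in U, w' \in U & J w' \in U],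
      forall x, exists t s al be, x = t *: e1 + s *: e6 + (al • w + be • w')
    & [/\ br e6 e1 = a *: e1 + (v1 • w + v2 • w'),
          br e6 w = m11 • w + m12 • w'
        & br e6 w' = m21 • w + m22 • w']].

Lemma cact_mem z x : x \in U -> J x \in U -> z • x \in U /\ J (z • x) \in U.
Proof.
move=> hx hJx; rewrite J_cact /cact JJ; split; apply: memvD; apply: memvZ => //.
by rewrite memvN.
Qed.

Lemma br_cact z x : x \in U -> J x \in U -> br e6 (z • x) = z • br e6 x.
Proof. by move=> hx hJx; rewrite /cact (brDr hbr) !(brZr hbr) brJ. Qed.

Lemma comb_cact z al be w w' :
  z • (al • w + be • w') = (z * al) • w + (z * be) • w'.
Proof. by rewrite cactDr !(cactA JJ). Qed.

Lemma combD al be al' be' w w' : (al • w + be • w') + (al' • w + be' • w') =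
  (al + al') • w + (be + be') • w'.
Proof. by rewrite !cactDl addrACA. Qed.

(** With P = (p, q; r, s) and d = (d1, d2), the new frame is P (w, w') and
    e1 + d (w, w'); the hypotheses are the equations P m = m' P and
    v + d m = a d + v' P in coordinates. *)
Lemma frame_change p q r s d1 d2 a v1 v2 m11 m12 m21 m22 v1' v2' m11' m12' m21' m22' :
  p * s - q * r != 0 ->
  p * m11 + q * m21 = m11' * p + m12' * r ->
  p * m12 + q * m22 = m11' * q + m12' * s ->
  r * m11 + s * m21 = m21' * p + m22' * r ->
  r * m12 + s * m22 = m21' * q + m22' * s ->
  v1 + d1 * m11 + d2 * m21 = (a%:C)%C * d1 + v1' * p + v2' * r ->
  v2 + d1 * m12 + d2 * m22 = (a%:C)%C * d2 + v1' * q + v2' * s ->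
  frame a v1 v2 m11 m12 m21 m22 -> frame a v1' v2' m11' m12' m21' m22'.
Proof.
move=> hdet h11 h12 h21 h22 hv1 hv2 [e1 [w [w' [[hU1 hw hJw hw' hJw'] hspan [hA1 hAw hAw']]]]].
have hcomb al be : (al • w + be • w' \in U) /\ (J (al • w + be • w') \in U).
  have [h1 h2] := cact_mem al hw hJw; have [h3 h4] := cact_mem be hw' hJw'.
  by rewrite linearD; split; apply: memvD.
have hAcomb al be : br e6 (al • w + be • w') =
    (al * m11 + be * m21) • w + (al * m12 + be * m22) • w'.
  by rewrite (brDr hbr) !br_cact // hAw hAw' !comb_cact combD.
exists (e1 + (d1 • w + d2 • w')), (p • w + q • w'), (r • w + s • w'); split.
- have [? ?] := hcomb p q; have [? ?] := hcomb r s; split=> //.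
  by apply: memvD => //; have [] := hcomb d1 d2.
- move=> x; have [t [l [al [be ->]]]] := hspan x.
  (* Subtract t *: (d1 • w + d2 • w'), then invert the matrix by Cramer's rule. *)
  pose al' := al - (t%:C)%C * d1; pose be' := be - (t%:C)%C * d2.
  exists t, l, ((al' * s - be' * r) / (p * s - q * r)), ((be' * p - al' * q) / (p * s - q * r)).
  rewrite !comb_cact combD scalerDr -[t *: (_ + _)](cact_real J) comb_cact.
  rewrite [in RHS](addrAC (t *: e1)) -[RHS]addrA combD /al' /be'.
  by congr (_ + (_ • _ + _ • _)); field.
split.
- rewrite (brDr hbr) hA1 hAcomb -addrA combD !comb_cact combD scalerDr.
  rewrite -[a *: (_ + _)](cact_real J) comb_cact -[RHS]addrA combD.
  by congr (_ + (_ • _ + _ • _)); rewrite addrA ?hv1 ?hv2 -addrA.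
- by rewrite hAcomb h11 h12 !comb_cact combD.
by rewrite hAcomb h21 h22 !comb_cact combD.
Qed.

(** The real matrix of ad e6 in the basis e1, w, J w, w', J w'. *)
Definition frame_rows (a : R) (v1 v2 m11 m12 m21 m22 : R[i]) (i k : nat) : R :=
  let row z z' := [:: 0; complex.Re z; complex.Im z; complex.Re z'; complex.Im z'] in
  let rowJ z z' := [:: 0; - complex.Im z; complex.Re z; - complex.Im z'; complex.Re z'] in
  nth 0 (nth [::] [:: a :: behead (row v1 v2); row m11 m12; rowJ m11 m12;
                      row m21 m22; rowJ m21 m22] i) k.

(** The target basis is c e6 together with the vectors e1, w, J w, w', J w' permuted
    by [sg] and rescaled by [mu]; the equation between the coefficients says that
    it brings ad (c e6) to the structure equations of [alpha]. *)
Lemma frame_isomorphic a v1 v2 m11 m12 m21 m22 alpha M (c : R) (sg : seq nat) (mu : seq R) :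
  \dim {:g} = 6%N ->
  frame a v1 v2 m11 m12 m21 m22 ->
  has_rows alpha M -> (forall l, M 6 l = 0) ->
  c != 0 -> perm_eq sg (iota 0 5) -> all (fun x => x != 0) mu -> size mu = 5%N ->
  (forall i k, (i < 5)%N -> (k < 5)%N ->
     M k.+1 i.+1 * mu`_k = c * mu`_i *
       frame_rows a v1 v2 m11 m12 m21 m22 (nth 0%N sg i) (nth 0%N sg k)) ->
  lie_isomorphic br (bracket_of alpha).
Proof.
move=> dim6 [e1 [w [w' [[hU1 hw hJw hw' hJw'] hspan [hA1 hAw hAw']]]]] hM M6 c0 hsg hmu smu hMN.
pose X := [:: e1; w; J w; w'; J w'].
pose fX i := mu`_i *: X`_(nth 0 sg i)%N.
pose f := [tuple fX 0; fX 1; fX 2; fX 3; fX 4; c *: e6].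
have fE i : (i < 5)%N -> f`_i = fX i by case: i => [|[|[|[|[|]]]]].
have ssg : size sg = 5%N by rewrite (perm_size hsg).
have hsgi i : (i < 5)%N -> (nth 0 sg i < 5)%N.
  move=> hi; have : nth 0%N sg i \in sg by rewrite mem_nth ?ssg.
  by rewrite (perm_mem hsg) mem_iota.
have hmu0 i : (i < 5)%N -> mu`_i != 0.
  by move=> hi; apply: (allP hmu); rewrite mem_nth ?smu.
have XU i : (i < 5)%N -> X`_i \in U by case: i => [|[|[|[|[|]]]]].
have fU i : (i < 5)%N -> f`_i \in U by move=> hi; rewrite fE // memvZ // XU // hsgi.
have Xf i : (i < 5)%N -> X`_i \in <<f>>%VS.
  move=> hi; have hii : i \in sg by rewrite (perm_mem hsg) mem_iota.
  have hj : (index i sg < 5)%N by rewrite -ssg index_mem.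
  rewrite -[X`_i]scale1r -(mulVf (hmu0 _ hj)) -scalerA memvZ //.
  have -> : mu`_(index i sg) *: X`_i = f`_(index i sg) by rewrite fE // /fX nth_index.
  by apply: memv_span; rewrite mem_nth ?size_tuple // ltnW.
have e6f : e6 \in <<f>>%VS.
  rewrite -[e6]scale1r -(mulVf c0) -scalerA memvZ //.
  by apply: memv_span; rewrite !inE eqxx !orbT.
have basis : basis_of fullv f.
  rewrite basisEdim size_tuple dim6 leqnn andbT; apply/subvP => x _.
  have [t [s [al [be ->]]]] := hspan x; rewrite /cact.
  have [hX0 hX1 hX2 hX3 hX4] := And5 (Xf 0 isT) (Xf 1 isT) (Xf 2 isT) (Xf 3 isT) (Xf 4 isT).
  by do ?[apply: memvD | apply: memvZ].
have AX j : (j < 5)%N -> br e6 X`_j =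
    \sum_(k < 5) frame_rows a v1 v2 m11 m12 m21 m22 j k *: X`_k.
  rewrite !big_ord_recl big_ord0.
  case: j => [|[|[|[|[|]]]]] //= _; rewrite ?brJ ?hA1 ?hAw ?hAw' // /cact;
  rewrite ?(linearD J) ?(linearZZ J) ?JJ /= /frame_rows /= ?scale0r ?add0r addr0 -?addrA //;
  rewrite !JJ !scalerN -!scaleNr addrCA; congr (_ + (_ + _)).
  - by rewrite addrC.
  - by rewrite addrC.
have hw6 := has_rows_wedge6 hM.
apply: (lie_isomorphic_basis hbr hw6 hU basis) => i //; first exact: fU.
rewrite [f`_5]/= (brZl hbr); case: (ltnP i 5) => hi; last first.
  have -> : i = ix 6.
    apply/val_inj; rewrite /= val_ix //; apply/eqP; rewrite eqn_leq hi andbT.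
    by rewrite -ltnS ltn_ord.
  rewrite big1 => [|k _]; last first.
    have := congr1 (fun x : 'rV_6 => x 0 k) (ad6_row6 hw6).
    by rewrite -rowE !mxE => ->; rewrite scale0r.
  by rewrite val_ix //= (brZr hbr) (lie_alternating hbr) !scaler0.
rewrite fE // (brZr hbr) AX ?hsgi //.
have ixE (l : 'I_6) : l = ix l.+1 by apply/val_inj; rewrite /= val_ix //= ltn_ord.
have adE (k : 'I_6) : ad6 alpha i k = M k.+1 i.+1.
  by rewrite {1}(ixE i) {1}(ixE k) (ad6_rows hM M6) //= ltn_ord.
transitivity (\sum_(k < 6) M k.+1 i.+1 *: f`_k); last first.
  by apply: eq_bigr => k _; congr (_ *: _); exact/esym/adE.
rewrite [RHS]big_ord_recr [X in _ = _ + X *: _]M6 scale0r addr0.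
rewrite scalerA scaler_sumr.
transitivity (\sum_(k < 5)
    (c * mu`_i * frame_rows a v1 v2 m11 m12 m21 m22 (nth 0 sg i)%N (nth 0 sg k)%N)
      *: X`_(nth 0 sg k)%N); last first.
  apply: eq_bigr => k _.
  have -> : f`_(widen_ord (leqnSn 5) k) = fX k by rewrite fE //; exact: (ltn_ord k).
  rewrite /fX [RHS]scalerA [X in _ = X *: _]hMN //; exact: (ltn_ord k).
have E (F : nat -> g) : \sum_(k < 5) F (nth 0%N sg k) = \sum_(k < 5) F k.
  rewrite -(big_mkord xpredT F) -(big_mkord xpredT (fun k => F (nth 0%N sg k))).
  by rewrite -{1}ssg -(big_nth 0%N xpredT F) (perm_big _ hsg).
have /= -> := E (fun k =>
  (c * mu`_i * frame_rows a v1 v2 m11 m12 m21 m22 (nth 0%N sg i) k) *: X`_k).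
by apply: eq_bigr => k _; rewrite scalerA.
Qed.
End Frames.

(** * Normal forms *)

Section NormalForms.
Variables (R : rcfType) (g : vectType R) (br : g -> g -> g) (U : {vspace g}).
Variables (J : 'End(g)) (e6 : g).
Hypothesis hbr : is_lie_bracket br.
Hypothesis JJ : forall x, J (J x) = - x.
Hypothesis brJ : forall x, x \in U -> J x \in U -> br e6 (J x) = J (br e6 x).
Local Notation frame := (frame br U J e6).
Local Notation "x %:C" := ((x%:C)%C : R[i]) (only parsing).
Local Notation change p q r s d1 d2 :=
  (frame_change hbr JJ brJ (p := p) (q := q) (r := r) (s := s) (d1 := d1) (d2 := d2)).

Lemma quadratic_root (b c : R[i]) : exists z, z * z - b * z + c = 0.
Proof.
exists ((b + sqrtc (b ^+ 2 - 4%:R * c)) / 2%:R).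
have := sqr_sqrtc (b ^+ 2 - 4%:R * c); move: (sqrtc _) => d hd.
have -> : c = (b ^+ 2 - d ^+ 2) / 4%:R by rewrite hd; field.
by field.
Qed.

Lemma frame_triangular a v1 v2 m11 m12 m21 m22 : frame a v1 v2 m11 m12 m21 m22 ->
  exists v1 v2 z c z', frame a v1 v2 z 0 c z'.
Proof.
move=> h; have [m0|m0] := eqVneq m12 0.
  by move: h; rewrite m0 => h; exists v1, v2, m11, m21, m22.
have [z hz] := quadratic_root (m11 + m22) (m11 * m22 - m12 * m21).
(* p w + w' is an eigenvector for the root z of the characteristic polynomial. *)
pose p := (z - m22) / m12.
exists v2, (v1 - v2 * p), z, m12, (m11 - p * m12).
apply: (change p 1 1 0 0 0 _ _ _ _ _ _ _ h); rewrite /p.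
- by rewrite mulr0 mulr1 sub0r oppr_eq0 oner_eq0.
- have -> : m21 = (z * z - (m11 + m22) * z + m11 * m22) / m12.
    rewrite -[LHS]addr0 -(mul0r m12^-1) -hz; by field.
  by field.
all: by field.
Qed.

(** Once m is triangular with eigenvalues z and z', the remaining entry is
    eliminated when z != z', and rescaled to 1 otherwise. *)
Lemma frame_jordan a v1 v2 m11 m12 m21 m22 : frame a v1 v2 m11 m12 m21 m22 ->
  (exists v1 v2 z z', frame a v1 v2 z 0 0 z') \/ (exists v1 v2 z, frame a v1 v2 z 0 1 z).
Proof.
case/frame_triangular => {}v1 [{}v2 [z [c [z' h]]]].
have [zz|zz] := eqVneq z z'; last first.
  have dz : z' - z != 0 by rewrite subr_eq0 eq_sym.
  left; exists (v1 - v2 * (c / (z' - z))), v2, z, z'.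
  by apply: (change 1 0 (c / (z' - z)) 1 0 0 _ _ _ _ _ _ _ h);
    rewrite ?mulr1 ?mul0r ?subr0 ?oner_eq0 //; field.
have [c0|c0] := eqVneq c 0.
  by left; exists v1, v2, z, z'; rewrite c0 in h.
right; exists (v1 / c), v2, z; rewrite -zz in h.
by apply: (change c 0 0 1 0 0 _ _ _ _ _ _ _ h); rewrite ?mulr1 ?mul0r ?subr0 //; field.
Qed.

(** Translating e1 removes from v its components on the generalized eigenspaces
    of the eigenvalues other than a, and its component in the image of m - a; what
    remains is normalized by the changes of (w, w') commuting with m. *)
Lemma frame_normal a v1 v2 m11 m12 m21 m22 : frame a v1 v2 m11 m12 m21 m22 ->
  [\/ exists z z', frame a 0 0 z 0 0 z', exists z', frame a 1 0 a%:C 0 0 z',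
      exists z, frame a 0 0 z 0 1 z | frame a 0 1 a%:C 0 1 a%:C].
Proof.
case/frame_jordan => [[{}v1 [{}v2 [z [z' h]]]]|[{}v1 [{}v2 [z h]]]].
  have [{}v1 [{}h hv1]] : exists v1, frame a v1 v2 z 0 0 z' /\ (v1 = 0 \/ z = a%:C).
    have [za|za] := eqVneq z a%:C; first by exists v1; split=> //; right.
    have dz : a%:C - z != 0 by rewrite subr_eq0 eq_sym.
    exists 0; split; last by left.
    by apply: (change 1 0 0 1 (v1 / (a%:C - z)) 0 _ _ _ _ _ _ _ h);
      rewrite ?mulr1 ?mul0r ?subr0 ?oner_eq0 //; field.
  have [{}v2 [{}h hv2]] : exists v2, frame a v1 v2 z 0 0 z' /\ (v2 = 0 \/ z' = a%:C).
    have [za|za] := eqVneq z' a%:C; first by exists v2; split=> //; right.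
    have dz : a%:C - z' != 0 by rewrite subr_eq0 eq_sym.
    exists 0; split; last by left.
    by apply: (change 1 0 0 1 0 (v2 / (a%:C - z')) _ _ _ _ _ _ _ h);
      rewrite ?mulr1 ?mul0r ?subr0 ?oner_eq0 //; field.
  have [v10|v10] := eqVneq v1 0; have [v20|v20] := eqVneq v2 0.
  - by apply: Or41; exists z, z'; rewrite v10 v20 in h.
  - have za : z' = a%:C by case: hv2 => // e; rewrite e eqxx in v20.
    apply: Or42; exists z; rewrite za v10 in h.
    by apply: (change 0 v2 1 0 0 0 _ _ _ _ _ _ _ h);
      rewrite ?mulr1 ?mul0r ?sub0r ?oppr_eq0 //; ring.
  - have za : z = a%:C by case: hv1 => // e; rewrite e eqxx in v10.
    apply: Or42; exists z'; rewrite za v20 in h.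
    by apply: (change v1 0 0 1 0 0 _ _ _ _ _ _ _ h); rewrite ?mulr1 ?mul0r ?subr0 //; ring.
  (* Here m is the scalar a, so that v itself can be taken as the new w. *)
  have za : z = a%:C by case: hv1 => // e; rewrite e eqxx in v10.
  have za' : z' = a%:C by case: hv2 => // e; rewrite e eqxx in v20.
  apply: Or42; exists z'; rewrite za za' in h *.
  by apply: (change v1 v2 0 1 0 0 _ _ _ _ _ _ _ h); rewrite ?mulr1 ?mulr0 ?subr0 //; ring.
have [za|za] := eqVneq z a%:C; last first.
  have dz : a%:C - z != 0 by rewrite subr_eq0 eq_sym.
  apply: Or43; exists z.
  by apply: (change 1 0 0 1 ((v1 + v2 / (a%:C - z)) / (a%:C - z)) (v2 / (a%:C - z))
      _ _ _ _ _ _ _ h);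
      rewrite ?mulr1 ?mul0r ?subr0 ?oner_eq0 //; field.
rewrite za in h.
(* The image of m - a is spanned by w; it is reached by translating e1 by w'. *)
have {}h : frame a 0 v2 a%:C 0 1 a%:C.
  by apply: (change 1 0 0 1 0 (- v1) _ _ _ _ _ _ _ h);
      rewrite ?mulr1 ?mul0r ?subr0 ?oner_eq0 //; ring.
have [v20|v20] := eqVneq v2 0; first by apply: Or43; exists a%:C; rewrite v20 in h.
apply: Or44.
by apply: (change v2 0 0 v2 0 0 _ _ _ _ _ _ _ h);
  rewrite ?mulr0 ?subr0 ?mulf_neq0 //; ring.
Qed.

Lemma frame_swap a z z' : frame a 0 0 z 0 0 z' -> frame a 0 0 z' 0 0 z.
Proof.
move=> h; by apply: (change 0 1 1 0 0 0 _ _ _ _ _ _ _ h);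
  rewrite ?mulr0 ?mulr1 ?sub0r ?oppr_eq0 ?oner_eq0 //; ring.
Qed.
End NormalForms.

(** * From normal forms to the list *)

Section Classification.
Variables (R : rcfType) (g : vectType R) (br : g -> g -> g) (U : {vspace g}).
Variables (J : 'End(g)) (e6 : g).
Hypothesis hbr : is_lie_bracket br.
Hypothesis hU : lie_abelian br U.
Hypothesis JJ : forall x, J (J x) = - x.
Hypothesis brJ : forall x, x \in U -> J x \in U -> br e6 (J x) = J (br e6 x).
Hypothesis dim6 : \dim {:g} = 6%N.
Local Notation frame := (frame br U J e6).

Definition isomorphic_to_listed := exists (alpha : 6.-tuple 'M[R]_6) (s : seq (nat * nat)),
  listed alpha s /\ lie_isomorphic br (bracket_of alpha).

Lemma ler_norm_pM2l (c u w : R) : c != 0 -> (`|c * u| <= `|c * w|) = (`|u| <= `|w|).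
Proof. by move=> c0; rewrite !normrM ler_pM2l ?normr_gt0. Qed.
Lemma ltr_norm_pM2l (c u w : R) : c != 0 -> (`|c * u| < `|c * w|) = (`|u| < `|w|).
Proof. by move=> c0; rewrite !normrM ltr_pM2l ?normr_gt0. Qed.
Lemma ler_norm_div1 (u w : R) : w != 0 -> (`|w^-1 * u| <= 1) = (`|u| <= `|w|).
Proof. by move=> w0; rewrite -(normr1 R) -(mulVf w0) ler_norm_pM2l ?invr_eq0. Qed.
Lemma ltr_norm_div1 (u w : R) : w != 0 -> (`|w^-1 * u| < 1) = (`|u| < `|w|).
Proof. by move=> w0; rewrite -(normr1 R) -(mulVf w0) ltr_norm_pM2l ?invr_eq0. Qed.

Definition norm_cond := (ler_norm_div1, ltr_norm_div1, ler_norm_pM2l, ltr_norm_pM2l,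
  normr_gt0, mulf_neq0, invr_eq0, oppr_eq0).

Ltac entries_tac :=
  move=> [|[|[|[|[|?]]]]] [|[|[|[|[|?]]]]] //= _ _; rewrite /frame_rows /=;
  (by rewrite ?(mulr0, mul0r, mulr1, mul1r, addr0, add0r, oppr0)) || by field.

Ltac iso_tac hfr c sg mu :=
  apply: (frame_isomorphic (c := c) (sg := sg) (mu := mu) hbr hU JJ brJ dim6 hfr);
  [rows_tac | by [] | by rewrite ?norm_cond ?oner_eq0 | by [] |
   by rewrite /= ?oner_eq0 ?invr_eq0 ?oppr_eq0 /=; do ?[apply/andP; split] | by [] |
   entries_tac].

Local Notation ones := [:: 1; 1; 1; 1; 1].

(** The vector e6 is divided by an eigenvalue of largest absolute value; the place
    of |a| with respect to |x'| <= |x| decides between the families. *)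
Lemma classify_real a x x' : `|x'| <= `|x| -> (a != 0) || (x != 0) ->
  frame a (Complex 0 0) (Complex 0 0) (Complex x 0) (Complex 0 0) (Complex 0 0) (Complex x' 0) ->
  isomorphic_to_listed.
Proof.
move=> hx hn h; have [a0|a0] := eqVneq a 0.
  move: hn h; rewrite a0 eqxx /= => x0 h.
  have [x'0|x'0] := eqVneq x' 0.
    do 2!eexists; split; first exact: k14.
    rewrite x'0 in h; iso_tac h x^-1 [:: 1; 2; 3; 4; 0]%N (ones : seq R).
  do 2!eexists; split; first by apply: (@k20 _ (x^-1 * x')); rewrite !norm_cond.
  iso_tac h x^-1 [:: 1; 2; 3; 4; 0]%N (ones : seq R).
have [x0|x0] := eqVneq x 0.
  have x'0 : x' = 0 by apply/eqP; rewrite -normr_le0 (le_trans hx) // x0 normr0.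
  do 2!eexists; split; first exact: k13.
  rewrite x0 x'0 in h; iso_tac h a^-1 [:: 0; 1; 2; 3; 4]%N (ones : seq R).
have [xa|ax] := lerP `|x| `|a|.
  have [x'0|x'0] := eqVneq x' 0.
    do 2!eexists; split; first by apply: (@k17 _ (a^-1 * x)); rewrite !norm_cond.
    rewrite x'0 in h; iso_tac h a^-1 [:: 0; 1; 2; 3; 4]%N (ones : seq R).
  do 2!eexists; split; first by apply: (@k1 _ (a^-1 * x) (a^-1 * x')); rewrite !norm_cond.
  iso_tac h a^-1 [:: 0; 1; 2; 3; 4]%N (ones : seq R).
have [x'0|x'0] := eqVneq x' 0.
  do 2!eexists; split; first by apply: (@k18 _ (x^-1 * a)); rewrite !norm_cond.
  rewrite x'0 in h; iso_tac h x^-1 [:: 1; 2; 0; 3; 4]%N (ones : seq R).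
have [x'a|ax'] := lerP `|x'| `|a|.
  do 2!eexists; split; first by apply: (@k2 _ (x^-1 * a) (x^-1 * x')); rewrite !norm_cond.
  iso_tac h x^-1 [:: 1; 2; 0; 3; 4]%N (ones : seq R).
do 2!eexists; split; first by apply: (@k3 _ (x^-1 * x') (x^-1 * a)); rewrite !norm_cond.
iso_tac h x^-1 [:: 1; 2; 3; 4; 0]%N (ones : seq R).
Qed.

(** The factor (- y')^-1 of e6 gives imaginary part - 1 to x' + i y': in the blocks
    (s f^46 + f^56, - f^46 + s f^56) with J f_4 = f_5 the eigenvalue is s - i. When
    a = 0 and x != 0, the real eigenvalue is normalized instead. *)
Lemma classify_mixed a x x' y' : y' != 0 ->
  frame a (Complex 0 0) (Complex 0 0) (Complex x 0) (Complex 0 0) (Complex 0 0) (Complex x' y') ->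
  isomorphic_to_listed.
Proof.
move=> y'0 h; have [a0|a0] := eqVneq a 0; have [x0|x0] := eqVneq x 0.
- do 2!eexists; split; first by apply: (@k15 _ ((- y')^-1 * x')).
  rewrite a0 x0 in h; iso_tac h (- y')^-1 [:: 3; 4; 0; 1; 2]%N (ones : seq R).
- do 2!eexists; split.
    by apply: (@k22 _ (x^-1 * x') (x^-1 * - y')); rewrite !norm_cond.
  rewrite a0 in h; iso_tac h x^-1 [:: 1; 2; 3; 4; 0]%N (ones : seq R).
- do 2!eexists; split.
    by apply: (@k19 _ ((- y')^-1 * a) ((- y')^-1 * x')); rewrite !norm_cond.
  rewrite x0 in h; iso_tac h (- y')^-1 [:: 0; 3; 4; 1; 2]%N (ones : seq R).
have [xa|ax] := lerP `|x| `|a|.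
  do 2!eexists; split.
    by apply: (@k8 _ ((- y')^-1 * a) ((- y')^-1 * x) ((- y')^-1 * x')); rewrite !norm_cond.
  iso_tac h (- y')^-1 [:: 0; 1; 2; 3; 4]%N (ones : seq R).
do 2!eexists; split.
  by apply: (@k9 _ ((- y')^-1 * x) ((- y')^-1 * a) ((- y')^-1 * x')); rewrite !norm_cond.
iso_tac h (- y')^-1 [:: 1; 2; 0; 3; 4]%N (ones : seq R).
Qed.

(** The eigenvalue with the larger real part in absolute value, or with the larger
    imaginary part in case of equality, is the one whose imaginary part is
    normalized. *)
Lemma classify_nonreal a x y x' y' : y != 0 -> y' != 0 ->
  `|x'| < `|x| \/ (`|x| = `|x'| /\ `|y'| <= `|y|) ->
  frame a (Complex 0 0) (Complex 0 0) (Complex x y) (Complex 0 0) (Complex 0 0) (Complex x' y') ->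
  isomorphic_to_listed.
Proof.
move=> y0 y'0 hxy h.
have {}hxy : `|(- y)^-1 * x'| < `|(- y)^-1 * x| \/
    (`|(- y)^-1 * x| = `|(- y)^-1 * x'| /\ `|(- y)^-1 * - y'| <= 1).
  rewrite !norm_cond // !normrN; case: hxy => [|[e]]; [by left|right].
  by rewrite !normrM e.
have [a0|a0] := eqVneq a 0; do 2!eexists; split.
- apply: (@k25 _ ((- y)^-1 * x) ((- y)^-1 * x') ((- y)^-1 * - y')).
  by split=> //; rewrite !norm_cond.
- rewrite a0 in h; iso_tac h (- y)^-1 [:: 1; 2; 3; 4; 0]%N (ones : seq R).
- apply: (@k11 _ ((- y)^-1 * a) ((- y)^-1 * x) ((- y)^-1 * x') ((- y)^-1 * - y')).
  by split=> //; rewrite !norm_cond.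
iso_tac h (- y)^-1 [:: 0; 1; 2; 3; 4]%N (ones : seq R).
Qed.

(** Multiplying e6 by c replaces w by c w in [e6, e1] = a e1 + w; the factor is
    absorbed by rescaling w, whence the entry c in the list of scalings. *)
Lemma classify_shear_real a x' : (a != 0) || (x' != 0) ->
  frame a (Complex 1 0) (Complex 0 0) (Complex a 0) (Complex 0 0) (Complex 0 0) (Complex x' 0) ->
  isomorphic_to_listed.
Proof.
move=> hn h; have [a0|a0] := eqVneq a 0.
  move: hn; rewrite a0 eqxx /= => x'0; do 2!eexists; split; first exact: k21.
  rewrite a0 in h; iso_tac h x'^-1 [:: 3; 4; 1; 0; 2]%N [:: 1; 1; x'^-1; 1; 1].
have [x'0|x'0] := eqVneq x' 0.
  do 2!eexists; split; first exact: k16.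
  rewrite x'0 in h; iso_tac h a^-1 [:: 2; 1; 0; 3; 4]%N [:: 1; a^-1; 1; 1; 1].
have [xa|ax] := lerP `|x'| `|a|.
  do 2!eexists; split; first by apply: (@k4 _ (a^-1 * x')); rewrite !norm_cond.
  iso_tac h a^-1 [:: 2; 1; 0; 3; 4]%N [:: 1; a^-1; 1; 1; 1].
do 2!eexists; split; first by apply: (@k5 _ (x'^-1 * a)); rewrite !norm_cond.
iso_tac h x'^-1 [:: 3; 1; 0; 4; 2]%N [:: 1; x'^-1; 1; 1; 1].
Qed.

Lemma classify_shear_nonreal a x' y' : y' != 0 ->
  frame a (Complex 1 0) (Complex 0 0) (Complex a 0) (Complex 0 0) (Complex 0 0) (Complex x' y') ->
  isomorphic_to_listed.
Proof.
move=> y'0 h; have [a0|a0] := eqVneq a 0; do 2!eexists; split.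
- by apply: (@k23 _ ((- y')^-1 * x')).
- rewrite a0 in h; iso_tac h (- y')^-1 [:: 3; 4; 1; 0; 2]%N [:: 1; 1; (- y')^-1; 1; 1].
- by apply: (@k10 _ ((- y')^-1 * a) ((- y')^-1 * x')); rewrite !norm_cond.
iso_tac h (- y')^-1 [:: 2; 1; 0; 3; 4]%N [:: 1; (- y')^-1; 1; 1; 1].
Qed.

(** The vector w is rescaled by the factor c of e6 in the real case, and by - c in
    the nonreal case, where the families couple the two blocks by minus the
    identity. *)
Lemma classify_jordan a x y : [|| a != 0, x != 0 | y != 0] ->
  frame a (Complex 0 0) (Complex 0 0) (Complex x y) (Complex 0 0) (Complex 1 0) (Complex x y) ->
  isomorphic_to_listed.
Proof.
move=> hn h; have [y0|y0] := eqVneq y 0; last first.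
  have [a0|a0] := eqVneq a 0; do 2!eexists; split.
  - by apply: (@k26 _ ((- y)^-1 * x)).
  - rewrite a0 in h; iso_tac h (- y)^-1 [:: 1; 2; 3; 4; 0]%N [:: y^-1; y^-1; 1; 1; 1].
  - by apply: (@k12 _ ((- y)^-1 * a) ((- y)^-1 * x)); rewrite !norm_cond.
  iso_tac h (- y)^-1 [:: 0; 1; 2; 3; 4]%N [:: 1; y^-1; y^-1; 1; 1].
move: hn h; rewrite y0 eqxx orbF; have [a0|a0] := eqVneq a 0 => /= hn h; do 2!eexists; split.
- exact: k24.
- rewrite a0 in h; iso_tac h x^-1 [:: 1; 3; 2; 4; 0]%N [:: x^-1; 1; x^-1; 1; 1].
- by apply: (@k6 _ (a^-1 * x)).
iso_tac h a^-1 [:: 0; 1; 3; 2; 4]%N [:: 1; a^-1; 1; a^-1; 1].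
Qed.

Lemma classify_jordan3 a : a != 0 ->
  frame a (Complex 0 0) (Complex 1 0) (Complex a 0) (Complex 0 0) (Complex 1 0) (Complex a 0) ->
  isomorphic_to_listed.
Proof.
move=> a0 h; do 2!eexists; split; first by apply: (@k7 _ a).
iso_tac h (1 : R) [:: 1; 3; 0; 2; 4]%N (ones : seq R).
Qed.
End Classification.

(** * Existence of frames *)

Section Existence.
Variables (R : rcfType) (g : vectType R) (br : g -> g -> g).
Hypothesis hbr : is_lie_bracket br.

Lemma dim_add_line (W : {vspace g}) u : u \notin W -> \dim (W + <[u]>) = (\dim W).+1.
Proof.
move=> hu; have u0 : u != 0 by apply: contraNneq hu => ->; rewrite mem0v.
have cap0 : (W :&: <[u]> = 0)%VS.
  apply/eqP; rewrite -subv0; apply/subvP => x; rewrite memv_cap memv0 => /andP[hx /vlineP[k xk]].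
  move: hx; rewrite xk; have [->|k0] := eqVneq k 0; first by rewrite scale0r eqxx.
  by rewrite rpredZeq (negPf k0) (negPf hu).
by rewrite dimv_disjoint_sum // dim_vline u0 addn1.
Qed.

Lemma exists_notin (W V : {vspace g}) : (\dim W < \dim V)%N -> exists2 u, u \in V & u \notin W.
Proof.
move=> hd; apply/subvPn; apply: contraTN hd => /dimvS; by rewrite -leqNgt.
Qed.

Section Almost.
Variables (U : {vspace g}) (J : 'End(g)).
Hypothesis JJ : forall x, J (J x) = - x.

(** If J u = w + k u with w in W, then J w + k w = - (1 + k^2) u, so that u lies
    in W. *)
Lemma dim_add_cplx_line (W : {vspace g}) u : (forall x, x \in W -> J x \in W) ->
  u \notin W -> \dim (W + <[u]> + <[J u]>) = (\dim W).+2.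
Proof.
move=> hW hu; rewrite dim_add_line ?dim_add_line //.
apply/negP => /memv_addP[w hw [_ /vlineP[k ->] Ju]].
have k0 : - 1 - k * k != 0 :> R.
  by rewrite -opprD oppr_eq0 gt_eqF // ltr_wpDr ?ltr01 // -expr2 sqr_ge0.
have : (- 1 - k * k) *: u \in W.
  have -> : (- 1 - k * k) *: u = J w + k *: w.
    rewrite scalerBl scaleN1r -JJ {1}Ju linearD linearZ /= Ju scalerDr scalerA.
    by rewrite -!addrA subrr addr0.
  by apply: memvD; [exact: hW | exact: memvZ].
by rewrite rpredZeq (negPf k0) (negPf hu).
Qed.

Lemma cplx_line_stable (W : {vspace g}) u : (forall x, x \in W -> J x \in W) ->
  forall x, x \in (W + <[u]> + <[J u]>)%VS -> J x \in (W + <[u]> + <[J u]>)%VS.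
Proof.
move=> hW _ /memv_addP[_ /memv_addP[w hw [_ /vlineP[k ->] ->]] [_ /vlineP[l ->] ->]].
rewrite !linearD !linearZ /= JJ addrAC; apply: memv_add; last by rewrite memvZ ?memv_line.
by apply: memv_add; [exact: hW | rewrite memvZ // memvN memv_line].
Qed.

Hypothesis dim6 : \dim {:g} = 6%N.
Hypothesis dimU : (\dim U).+1 = \dim {:g}.
Hypothesis idealU : lie_ideal br U.
Hypothesis abU : lie_abelian br U.
Hypothesis nij : forall x y, nijenhuis br J x y = 0.

(** The complex lines of w and w' fill U /\ J U: with one more complex line U would
    have dimension six. In particular any e1 in U outside of them has J e1 outside
    of U. *)
Lemma exists_frame : exists e6,
  (forall x, x \in U -> J x \in U -> br e6 (J x) = J (br e6 x)) /\
  exists a v1 v2 m11 m12 m21 m22, frame br U J e6 a v1 v2 m11 m12 m21 m22.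
Proof.
have dimU5 : \dim U = 5%N by move: dimU; rewrite dim6 => -[].
pose n1 := (U :&: (J @: U))%VS.
have n1P x : (x \in n1) = (x \in U) && (J x \in U).
  rewrite memv_cap; congr andb; apply/idP/idP.
    by case/memv_imgP => u hu ->; rewrite JJ memvN.
  move=> hx; have -> : x = J (- J x) by rewrite linearN /= JJ opprK.
  by rewrite memv_img // memvN.
have n1J x : x \in n1 -> J x \in n1 by rewrite !n1P JJ memvN andbC.
have dim_n1 : (4 <= \dim n1)%N.
  have hJ : (U :&: lker J = 0)%VS.
    apply/eqP; rewrite -subv0; apply/subvP => x; rewrite memv_cap memv_ker memv0.
    by case/andP => _ /eqP Jx; rewrite -oppr_eq0 -JJ Jx linear0.
  have := dimv_sum_cap U (J @: U)%VS; rewrite (limg_dim_eq hJ) dimU5 -/n1 => h.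
  have : (\dim (U + J @: U) <= 6)%N by rewrite -dim6 dimvS ?subvf.
  by rewrite -(leq_add2r (\dim n1)) h -[(5 + 5)%N]/(6 + 4)%N leq_add2l.
have [w hw w0] : exists2 u, u \in n1 & u \notin 0%VS.
  by apply: exists_notin; rewrite dimv0; apply: leq_trans dim_n1.
pose W1 := (0 + <[w]> + <[J w]>)%VS.
have st0 x : x \in (0%VS : {vspace g}) -> J x \in (0%VS : {vspace g}).
  by rewrite !memv0 => /eqP->; rewrite linear0.
have dW1 : \dim W1 = 2%N by rewrite /W1 dim_add_cplx_line // dimv0.
have [w' hw' w'W] : exists2 u, u \in n1 & u \notin W1.
  by apply: exists_notin; rewrite dW1; apply: leq_trans dim_n1.
have st1 := cplx_line_stable (u := w) st0.
pose W2 := (W1 + <[w']> + <[J w']>)%VS.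
have dW2 : \dim W2 = 4%N by rewrite /W2 dim_add_cplx_line // dW1.
have st2 := cplx_line_stable (u := w') st1.
have line_n1 u : u \in n1 -> (<[u]> <= n1)%VS by rewrite -memvE.
have W2n1 : (W2 <= n1)%VS by rewrite !subv_add sub0v !line_n1 ?n1J.
have n1U : (n1 <= U)%VS by exact: capvSl.
have [e1 he1 e1W] : exists2 u, u \in U & u \notin W2.
  by apply: exists_notin; rewrite dW2 dimU5.
have n1W2 : (n1 <= W2)%VS.
  apply/negPn/negP => /subvPn[u hu huW].
  have : (W2 + <[u]> + <[J u]> <= U)%VS.
    by rewrite 2!subv_add (subv_trans W2n1) // !(subv_trans (line_n1 _ _) n1U) ?n1J.
  by move/dimvS; rewrite dim_add_cplx_line // dW2 dimU5.
have Je1 : J e1 \notin U.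
  by apply: contra e1W => h; apply: (subvP n1W2); rewrite n1P he1.
have [[hwU hJwU] [hw'U hJw'U]] : (w \in U /\ J w \in U) /\ (w' \in U /\ J w' \in U).
  by move: hw hw'; rewrite !n1P => /andP[-> ->] /andP[-> ->].
have brJ x : x \in U -> J x \in U -> br (J e1) (J x) = J (br (J e1) x).
  move=> hx hJx; have := nij x (J e1); rewrite /nijenhuis JJ.
  have he : - e1 \in U by rewrite memvN.
  rewrite (abU hx he) (abU hJx he) addr0 subr0.
  rewrite (brC hbr x) (brC hbr (J x)) => /(congr1 J).
  rewrite linear0 linearD /= JJ linearN /= opprK addrC => /eqP.
  by rewrite subr_eq0 => /eqP.
have UW : (U = W2 + <[e1]>)%VS.
  apply/esym/eqP; rewrite eqEdim subv_add (subv_trans W2n1) //= -memvE he1 /=.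
  by rewrite dim_add_line // dW2 dimU5.
have fullU : (fullv = U + <[J e1]>)%VS.
  by apply/esym/eqP; rewrite eqEdim subvf dim_add_line // dimU leqnn.
have W2E v : v \in W2 -> exists al be, v = cact J al w + cact J be w'.
  case/memv_addP => _ /memv_addP[v1 hv1 [_ /vlineP[k ->] ->]] [_ /vlineP[l ->] ->].
  case/memv_addP: hv1 => _ /memv_addP[z hz [_ /vlineP[k' ->] ->]] [_ /vlineP[l' ->] ->].
  exists (Complex k' l'), (Complex k l); rewrite /cact /=.
  by move: hz; rewrite memv0 => /eqP->; rewrite add0r addrA.
have UE x : x \in U -> exists t al be, x = t *: e1 + (cact J al w + cact J be w').
  rewrite UW => /memv_addP[v /W2E[al [be ->]] [_ /vlineP[t ->] ->]].
  by exists t, al, be; rewrite addrC.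
have An1 x : x \in n1 -> exists al be, br (J e1) x = cact J al w + cact J be w'.
  rewrite n1P => /andP[hx hJx]; apply/W2E/(subvP n1W2).
  by rewrite n1P -brJ // !idealU.
exists (J e1); split=> //.
have [a [v1 [v2 hA1]]] := UE _ (idealU (J e1) he1).
have [m11 [m12 hAw]] := An1 _ hw; have [m21 [m22 hAw']] := An1 _ hw'.
exists a, v1, v2, m11, m12, m21, m22, e1, w, w'; split=> // x.
have : x \in (U + <[J e1]>)%VS by rewrite -fullU memvf.
case/memv_addP => _ /UE[t [al [be ->]]] [_ /vlineP[s ->] ->].
by exists t, s, al, be; rewrite addrAC.
Qed.
End Almost.

(** * Nilpotency *)

Section Nilpotent.
Variables (U : {vspace g}) (J : 'End(g)) (e6 : g).
Hypothesis abU : lie_abelian br U.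
Hypothesis JJ : forall x, J (J x) = - x.
Hypothesis brJ : forall x, x \in U -> J x \in U -> br e6 (J x) = J (br e6 x).

Lemma lie_prodv_sub (V W X : {vspace g}) :
  (forall x y, x \in V -> y \in W -> br x y \in X) -> (lie_prodv br V W <= X)%VS.
Proof.
move=> h; apply/span_subvP => _ /allpairsP[[x y] [hx hy ->]].
by apply: h; exact: vbasis_mem.
Qed.

(** When all eigenvalues vanish, ad e6 has cube zero and the lower central
    series decreases along its iterated images. *)
Lemma frame_nilpotent v1 v2 m21 : frame br U J e6 0 v1 v2 0 0 m21 0 -> nilpotent_lie br.
Proof.
move=> [e1 [w [w' [[hU1 hw hJw hw' hJw'] hspan [hA1 hAw hAw']]]]].
have {}hAw : br e6 w = 0 by rewrite hAw !cact0 addr0.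
have {}hAw' : br e6 w' = cact J m21 w by rewrite hAw' cact0 addr0.
have {}hA1 : br e6 e1 = cact J v1 w + cact J v2 w' by rewrite hA1 scale0r add0r.
have Aw z : br e6 (cact J z w) = 0.
  by rewrite (br_cact hbr brJ) // hAw /cact (linear0 J) !scaler0 addr0.
have Aw' z : br e6 (cact J z w') = cact J (z * m21) w.
  by rewrite (br_cact hbr brJ) // hAw' (cactA JJ).
have AE t s al be : br e6 (t *: e1 + s *: e6 + (cact J al w + cact J be w')) =
    t *: (cact J v1 w + cact J v2 w') + cact J (be * m21) w.
  rewrite 3!(brDr hbr) 2!(brZr hbr) hA1 (lie_alternating hbr) scaler0 addr0.
  by rewrite Aw Aw' add0r.
have AU x : br e6 x \in U.
  have [t [s [al [be ->]]]] := hspan x; rewrite AE.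
  have h z y : y \in U -> J y \in U -> cact J z y \in U.
    by move=> hy hJy; have [] := cact_mem JJ z hy hJy.
  by apply: memvD; [apply: memvZ; apply: memvD|]; apply: h.
have A3 x : br e6 (br e6 (br e6 x)) = 0.
  have [t [s [al [be ->]]]] := hspan x; rewrite AE.
  rewrite (brDr hbr) Aw addr0 (brZr hbr) (brDr hbr) Aw Aw' add0r.
  by rewrite (brZr hbr) Aw scaler0.
pose A : {linear g -> g} := HB.pack (br e6)
  (GRing.isLinear.Build R g g _ (br e6) (lie_linearr hbr e6)).
pose F : 'End(g) := linfun A.
have FE x : F x = br e6 x by rewrite lfunE.
have dec x : exists s, x - s *: e6 \in U.
  have [t [s [al [be ->]]]] := hspan x; exists s.
  rewrite addrAC addrK.
  have h z y : y \in U -> J y \in U -> cact J z y \in U.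
    by move=> hy hJy; have [] := cact_mem JJ z hy hJy.
  by apply: memvD; [apply: memvZ | apply: memvD; apply: h].
have brE x y s l : x - s *: e6 \in U -> y - l *: e6 \in U ->
    br x y = F (s *: y - l *: x).
  move=> hx hy; rewrite -(subrK (s *: e6) x) -(subrK (l *: e6) y).
  move: (x - _) (y - _) hx hy => {}x {}y hx hy.
  have -> : s *: (y + l *: e6) - l *: (x + s *: e6) = s *: y - l *: x.
    by rewrite !scalerDr !scalerA [l * s]mulrC opprD addrACA subrr addr0.
  rewrite FE (brDl hbr) 3!(brDr hbr) (abU hx hy) add0r -scaleNr !(brZr hbr) !(brZl hbr).
  by rewrite (lie_alternating hbr) !scaler0 addr0 (brC hbr x) scalerN -scaleNr addrC.
exists 3%N; apply/eqP; rewrite -subv0 /=.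
have step (W : {vspace g}) : (W <= U)%VS -> (lie_prodv br fullv W <= F @: W)%VS.
  move=> hW; apply: lie_prodv_sub => x y _ hy; have [s hs] := dec x.
  have hy0 : y - 0 *: e6 \in U by rewrite scale0r subr0 (subvP hW).
  by rewrite (brE _ _ _ _ hs hy0) scale0r subr0 memv_img // memvZ.
have FU (W : {vspace g}) : (F @: W <= U)%VS.
  by apply/subvP => _ /memv_imgP[x _ ->]; rewrite FE AU.
have h1 : (lie_prodv br fullv fullv <= F @: fullv)%VS.
  apply: lie_prodv_sub => x y _ _; have [s hs] := dec x; have [l hl] := dec y.
  by rewrite (brE _ _ _ _ hs hl) memv_img ?memvf.
have h2 := subv_trans (step _ (subv_trans h1 (FU _))) (limgS F h1).
have h3 := subv_trans (step _ (subv_trans h2 (FU _))) (limgS F h2).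
apply: (subv_trans h3); apply/subvP => _ /memv_imgP[_ /memv_imgP[_ /memv_imgP[x _ ->] ->] ->].
by rewrite !FE A3 mem0v.
Qed.
End Nilpotent.
End Existence.

(** * The classification *)

Lemma complex_structure_transport (R : fieldType) (V W : vectType R)
    (brV : V -> V -> V) (brW : W -> W -> W) :
  lie_isomorphic brV brW ->
  (exists J : 'End(W), complex_structure brW J) ->
  exists J : 'End(V), complex_structure brV J.
Proof.
case=> phi [[psi phiK psiK] phi_br] [J [JJ nijJ]].
have ker0 : lker phi == 0%VS by apply/lker0P; exact: can_inj phiK.
have phiE x : phi ((phi^-1 \o (J \o phi))%VF x) = J (phi x).
  by rewrite !comp_lfunE /= -[J _]psiK (lker0_lfunK ker0).
exists (phi^-1 \o (J \o phi))%VF; split=> [x|x y].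
  by apply: (can_inj phiK); rewrite !phiE JJ linearN.
apply: (can_inj phiK); rewrite linear0 -(nijJ (phi x) (phi y)) /nijenhuis.
by rewrite !(linearB phi, linearD phi) /= phiE linearD /= !phi_br !phiE.
Qed.

Section MainProof.
Variables (R : rcfType) (g : vectType R) (br : g -> g -> g) (U : {vspace g}).
Variables (J : 'End(g)) (e6 : g).
Hypothesis hbr : is_lie_bracket br.
Hypothesis hU : lie_abelian br U.
Hypothesis JJ : forall x, J (J x) = - x.
Hypothesis brJ : forall x, x \in U -> J x \in U -> br e6 (J x) = J (br e6 x).
Hypothesis dim6 : \dim {:g} = 6%N.
Hypothesis not_nil : ~ nilpotent_lie br.

Lemma frame_isomorphic_to_listed a v1 v2 m11 m12 m21 m22 :
  frame br U J e6 a v1 v2 m11 m12 m21 m22 -> isomorphic_to_listed br.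
Proof.
have nil := frame_nilpotent hbr hU JJ brJ.
case/(frame_normal hbr JJ brJ) => [[[x y] [[x' y'] h]]|[[x' y'] h]|[[x y] h]|h].
- have h' := frame_swap hbr JJ brJ h.
  have [y0|y0] := eqVneq y 0; have [y'0|y'0] := eqVneq y' 0.
  + rewrite y0 y'0 in h h'.
    have nz : [|| a != 0, x != 0 | x' != 0].
      rewrite -!negb_and; apply/negP => /and3P[/eqP a0 /eqP x0 /eqP x'0].
      by apply: not_nil; rewrite a0 x0 x'0 in h; apply: nil h.
    have [hx|/ltW hx] := lerP `|x'| `|x|.
      apply: (classify_real hbr hU JJ brJ dim6 hx _ h).
      case/or3P: nz => [->|->|x'0]; rewrite ?orbT // orbC -normr_gt0.
      by rewrite (lt_le_trans _ hx) ?normr_gt0.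
    apply: (classify_real hbr hU JJ brJ dim6 hx _ h').
    by case/or3P: nz => [->|x0|->]; rewrite ?orbT // orbC -normr_gt0 (lt_le_trans _ hx) ?normr_gt0.
  + by rewrite y0 in h; apply: (classify_mixed hbr hU JJ brJ dim6 y'0 h).
  + by rewrite y'0 in h'; apply: (classify_mixed hbr hU JJ brJ dim6 y0 h').
  have [lt|gt|e] := ltgtP `|x'| `|x|.
  + by apply: (classify_nonreal hbr hU JJ brJ dim6 y0 y'0 _ h); left.
  + by apply: (classify_nonreal hbr hU JJ brJ dim6 y'0 y0 _ h'); left.
  have [hy|/ltW hy] := lerP `|y'| `|y|.
    by apply: (classify_nonreal hbr hU JJ brJ dim6 y0 y'0 _ h); right.
  by apply: (classify_nonreal hbr hU JJ brJ dim6 y'0 y0 _ h'); right.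
- have [y'0|y'0] := eqVneq y' 0; last exact: (classify_shear_nonreal hbr hU JJ brJ dim6 y'0 h).
  rewrite y'0 in h; apply: (classify_shear_real hbr hU JJ brJ dim6 _ h).
  rewrite -negb_and; apply/negP => /andP[/eqP a0 /eqP x'0].
  by apply: not_nil; rewrite a0 x'0 in h; apply: nil h.
- apply: (classify_jordan hbr hU JJ brJ dim6 _ h).
  rewrite -!negb_and; apply/negP => /and3P[/eqP a0 /eqP x0 /eqP y0].
  by apply: not_nil; rewrite a0 x0 y0 in h; apply: nil h.
apply: (classify_jordan3 hbr hU JJ brJ dim6 _ h).
by apply/negP => /eqP a0; apply: not_nil; rewrite a0 in h; apply: nil h.
Qed.
End MainProof.

Theorem theorem3p2 (R : realType) :
  (forall (g : vectType R) (br : g -> g -> g),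
     is_lie_bracket br -> \dim {:g} = 6%N ->
     almost_abelian br -> ~ nilpotent_lie br ->
     (exists J : 'End(g), complex_structure br J) <->
     (exists (alpha : 6.-tuple 'M[R]_6) (s : seq (nat * nat)),
        listed alpha s /\ lie_isomorphic br (bracket_of alpha))) /\
  (forall (alpha : 6.-tuple 'M[R]_6) (s : seq (nat * nat)),
     listed alpha s ->
     is_lie_bracket (bracket_of alpha) /\
     exists J : 'End('rV[R]_6),
       complex_structure (bracket_of alpha) J /\ specified_by J s).
Proof.
split; last exact: listed_complex_structure.
move=> g br hbr dim6 [U [dimU idU abU]] not_nil; split; last first.
  move=> [alpha [s [hl hiso]]]; have [_ [J [hJ _]]] := listed_complex_structure hl.
  by apply: (complex_structure_transport hiso); exists J.
move=> [J [JJ nij]].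
have [e6 [brJ [a [v1 [v2 [m11 [m12 [m21 [m22 h]]]]]]]]] :=
  exists_frame hbr JJ dim6 dimU idU abU nij.
exact: (frame_isomorphic_to_listed hbr abU JJ brJ dim6 not_nil h).
Qed.
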